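(* For a suitable choice of $\delta\ge 1$ (namely $\delta = 2.0543$), Algorithm $A3(\delta)$ is a $2.17$-approximation for the Squared Metric Facility Location Problem.
   Context: Facility Location Problem: given finite disjoint sets $C$ (cities), $F$ (facilities), non-negative costs $c_{ij}$ and $f_i$, find $F'\subseteq F$ minimizing $\sum_{i\in F'}f_i+\sum_{j\in C}\min_{i\in F'}c_{ij}$. Squared metric instances satisfy $\sqrt{c_{ij}}\le \sqrt{c_{ij'}}+\sqrt{c_{i'j'}}+\sqrt{c_{i'j}}$ for all facilities $i,i'$ and cities $j,j'$. Algorithm $A2$: initially all facilities are unopened, all cities unconnected ($U:=C$), each city $j$ has budget $\alpha_j=0$. At each moment, an unconnected city $j$ offers $\max(\alpha_j-c_{ij},0)$ to each unopened facility $i$, and a city $j$ connected to facility $i'$ offers $\max(c_{i'j}-c_{ij},0)$ to $i$. While $U\neq\emptyset$, the budgets of all unconnected cities increase continuously at the same rate until: (a) for some unconnected $j$ and open $i$, $\alpha_j=c_{ij}$: connect $j$ to $i$ and remove $j$ from $U$; or (b) for some unopened $i$ the total offer received equals $f_i$: open $i$, connect to $i$ every city with a positive offer to $i$ (reconnecting if already connected), and remove the connected cities from $U$. Algorithm $A3(\delta)$: (1) multiply all facility costs by $\delta$ and run $A2$ on the scaled instance; (2) greedy augmentation with original costs: while some unopened facility would reduce the total cost if opened, compute for each unopened $i$ its gain $g_i$ (decrease in total cost if $i$ is opened) and open a facility maximizing $g_i/f_i$. *)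

(* Defs.v *)
From HB Require Import structures.
From mathcomp Require Import all_boot all_order all_algebra.
From mathcomp Require Import reals.
Set Implicit Arguments. Unset Strict Implicit. Unset Printing Implicit Defensive.
Import Order.TTheory GRing.Theory Num.Theory.
Local Open Scope ring_scope.

Section FL.
Variables (R : realType) (C F : finType).

Definition squared_metric (c : F -> C -> R) : Prop :=
  forall (i i' : F) (j j' : C),
    Num.sqrt (c i j) <= Num.sqrt (c i j') + Num.sqrt (c i' j') + Num.sqrt (c i' j).

(* Connection cost of city j in solution S: min_{i in S} c i j
   (only used for nonempty S; set to 0 when S is empty). *)
Definition conn_cost (c : F -> C -> R) (S : {set F}) (j : C) : R :=
  match [pick i in S] with
  | Some i0 => \big[Num.min/c i0 j]_(i in S) c i j
  | None => 0
  end.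

Definition cost (f : F -> R) (c : F -> C -> R) (S : {set F}) : R :=
  \sum_(i in S) f i + \sum_j conn_cost c S j.

(* State of A2: the current time t (= common budget alpha_j of all
   unconnected cities), the set of open facilities, and for every city
   the facility it is connected to (None = unconnected, i.e. j in U). *)
Record A2state := mkA2state {
  st_time : R;
  st_open : {set F};
  st_conn : C -> option F }.

Definition A2init : A2state := mkA2state 0 set0 (fun _ => None).

Definition unconnected (st : A2state) (j : C) : bool := st_conn st j == None.

(* offer of city j to facility i if the budget of unconnected cities is s *)
Definition city_offer (c : F -> C -> R) (st : A2state) (s : R) (j : C) (i : F) : R :=
  match st_conn st j with
  | None => Num.max (s - c i j) 0
  | Some i' => Num.max (c i' j - c i j) 0
  end.

Definition total_offer (c : F -> C -> R) (st : A2state) (s : R) (i : F) : R :=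
  \sum_j city_offer c st s j i.

Definition trigger (f : F -> R) (c : F -> C -> R) (st : A2state) (s : R) : Prop :=
  (exists j i, unconnected st j /\ i \in st_open st /\ s = c i j) \/
  (exists i, i \notin st_open st /\ total_offer c st s i = f i).

(* One step of A2: budgets rise from the current time to the first time t'
   at which an event happens; then one event happening at t' is processed
   (ties are broken arbitrarily). *)
Definition A2step (f : F -> R) (c : F -> C -> R) (st st' : A2state) : Prop :=
  (exists j, unconnected st j) /\
  exists t', st_time st <= t' /\ trigger f c st t' /\
    (forall s, st_time st <= s -> s < t' -> ~ trigger f c st s) /\
    (
      (exists j i, unconnected st j /\ i \in st_open st /\ t' = c i j /\
         st' = mkA2state t' (st_open st)
                 (fun k => if k == j then Some i else st_conn st k))
   \/
      (exists i, i \notin st_open st /\ total_offer c st t' i = f i /\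
         st' = mkA2state t' (i |: st_open st)
                 (fun k => if 0 < city_offer c st t' k i then Some i
                           else st_conn st k))).

Inductive A2reach (f : F -> R) (c : F -> C -> R) : A2state -> Prop :=
| A2reach_init : A2reach f c A2init
| A2reach_step st st' : A2reach f c st -> A2step f c st st' -> A2reach f c st'.

Definition A2 (f : F -> R) (c : F -> C -> R) (S : {set F}) : Prop :=
  exists st, A2reach f c st /\ (forall j, ~~ unconnected st j) /\ st_open st = S.

Definition gain (f : F -> R) (c : F -> C -> R) (S : {set F}) (i : F) : R :=
  cost f c S - cost f c (i |: S).

(* i maximizes g_i / f_i among unopened facilities (ratio compared by
   cross-multiplication, so that f_i = 0 with g_i > 0 counts as +infinity). *)
Definition greedy_step (f : F -> R) (c : F -> C -> R) (S S' : {set F}) : Prop :=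
  (exists k, k \notin S /\ 0 < gain f c S k) /\
  exists i, i \notin S /\ 0 < gain f c S i /\
    (forall k, k \notin S -> gain f c S k * f i <= gain f c S i * f k) /\
    S' = i |: S.

Inductive greedy_reach (f : F -> R) (c : F -> C -> R) (S0 : {set F}) : {set F} -> Prop :=
| greedy_refl : greedy_reach f c S0 S0
| greedy_next S S' : greedy_reach f c S0 S -> greedy_step f c S S' -> greedy_reach f c S0 S'.

Definition A3 (delta : R) (f : F -> R) (c : F -> C -> R) (S : {set F}) : Prop :=
  exists S0, A2 (fun i => delta * f i) c S0 /\ greedy_reach f c S0 S /\
    ~ (exists k, k \notin S /\ 0 < gain f c S k).

End FL.

(* Main.v *)
Require Import Defs.
From HB Require Import structures.
From Stdlib Require Import NArith.
From mathcomp Require Import all_boot all_order all_algebra.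
From mathcomp Require Import boolp reals sequences exp.
From mathcomp Require Import ring lra zify.
From mathcomp Require Import finset.
Set Implicit Arguments. Unset Strict Implicit. Unset Printing Implicit Defensive.
Import Order.TTheory GRing.Theory Num.Theory.
Local Open Scope ring_scope.

(* At the moment a city is connected, no unopened facility has been offered more
   than its cost. Ordering the cities of a star by time of connection, this
   bounds their budgets by a linear program whose constraints are the offers and
   the squared triangle inequality, the latter used through its tangents.
   Duplicating each city 200 times and averaging over 200 blocks of equal size
   gives a finite program that does not depend on the size of the star; an
   explicit dual solution yields budgets at most 1.45 times the opening cost plus
   3.4035 times the connection cost of any solution.
   Greedy augmentation never increases "opening cost + potential of the
   connection cost", for a concave potential that is logarithmic above the cost
   of the compared solution; its tangent at slope 1/2.0543 combines with the
   bound on the first phase, and 1.45 + ln 2.0543 <= 2.17 as well as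
   1 + 2.4035 / 2.0543 <= 2.17. *)

(** * Summation by parts and the dual of the block program *)

Section Abel.
Variable R : realFieldType.
Implicit Types (x g : nat -> R) (n : nat).

Lemma sum_mul_nonincreasing_ge0 n x g :
  (forall i, 0 <= g i) -> (forall i, g i.+1 <= g i) ->
  (forall k, (k <= n)%N -> 0 <= \sum_(i < k) x i) ->
  0 <= \sum_(i < n) x i * g i.
Proof.
move=> g0 gd xs.
(* Abel summation in a form that passes through induction: lowering [g n] to [g n.+1] costs nothing
   because the prefix sums are nonnegative. *)
suff H : (\sum_(i < n) x i) * g n <= \sum_(i < n) x i * g i.
  by apply: le_trans H; rewrite mulr_ge0 ?xs.
elim: n xs => [|n IH] xs; first by rewrite !big_ord0 mul0r.
rewrite [leRHS]big_ord_recr /= (le_trans (ler_wpM2l (xs _ (leqnn _)) (gd n))) //.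
by rewrite big_ord_recr /= mulrDl lerD2r IH // => k kn; rewrite xs // ltnW.
Qed.

Lemma sum_mul_nondecreasing_ge0 n x g :
  (forall i, (i < n)%N -> 0 <= g i) ->
  (forall i j, (i <= j)%N -> (j < n)%N -> g i <= g j) ->
  (forall k, (k < n)%N -> 0 <= \sum_(i < n | (k <= i)%N) x i) ->
  0 <= \sum_(i < n) x i * g i.
Proof.
move=> g0 gi xs.
(* Reversal turns suffix sums into prefix sums; [h] is 0 from [n] on, so that it is nonnegative and
   nonincreasing on all naturals. *)
pose y i := x (n - i.+1)%N; pose h i := if (i < n)%N then g (n - i.+1)%N else 0.
suff: 0 <= \sum_(i < n) y i * h i.
  rewrite (reindex_inj rev_ord_inj) /= (eq_bigr (fun i : 'I_n => x i * g i)) //.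
  by move=> i _; rewrite /y /h ltn_subrL (leq_ltn_trans (leq0n i) (ltn_ord i)) /=
    subnSK // subKn // ltnW.
apply: sum_mul_nonincreasing_ge0.
- by move=> i; rewrite /h; case: ifP => // ltin; apply: g0; lia.
- move=> i; rewrite /h; case: (ltnP i.+1 n) => ltin.
    by rewrite (ltnW ltin); apply: gi; lia.
  by case: ifP => // lt0; apply: g0; lia.
- move=> [|k] lekn; first by rewrite big_ord0.
  have -> : \sum_(i < k.+1) y i = \sum_(i < n | (n - k.+1 <= i)%N) x i; last by apply: xs; lia.
  rewrite (big_ord_widen n y lekn) (reindex_inj rev_ord_inj) /=.
  apply: eq_big => i; first by move: (ltn_ord i); lia.
  by move=> _; rewrite /y subnSK // subKn // ltnW.
Qed.

End Abel.

Lemma sum_ord_interval_const (R : pzSemiRingType) (t a b : nat) (x : R) :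
  (b <= t)%N -> \sum_(j < t | (a <= j < b)%N) x = (b - a)%:R * x.
Proof.
move=> bt; rewrite mulr_natl -sumr_const_nat big_geq_mkord.
by rewrite (big_ord_widen_cond _ _ (fun=> x) bt); apply: eq_bigl => j /=; rewrite andbC.
Qed.

(* [A] and [D] are the sums of the budgets and of the distances over each block.
   The dual weights are [w] for the offers and [o] for the tangents [T], which
   bound from below the connection costs of all earlier cities. *)
Section BlockProgram.
Variables (R : realFieldType) (t : nat) (cap : nat -> nat).
Variables (w o P Q u v A D : nat -> R) (phi gf gc : R).
Hypothesis w_ge0 : forall i, 0 <= w i.
Hypothesis o_ge0 : forall i, 0 <= o i.
Hypothesis P_ge0 : forall i, 0 <= P i.
Hypothesis A_ge0 : forall i, (i < t)%N -> 0 <= A i.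
Hypothesis D_ge0 : forall i, (i < t)%N -> 0 <= D i.
Hypothesis phi_ge0 : 0 <= phi.
Hypothesis A_nondecreasing : forall i j, (i <= j)%N -> (j < t)%N -> A i <= A j.

Let T i := u i * A i - v i * D i.

Hypothesis offer : forall (l : 'I_t) G, G = 0 \/ (exists2 i : 'I_t, (l < i)%N & G = T i) ->
  \sum_(j < t | (j <= l)%N) (P j * G - Q j * D j)
    + \sum_(j < t | (l < j < cap l)%N) (A l - D j) <= phi.
Hypothesis weight_le : \sum_(l < t) w l <= gf.
(** Dual feasibility is only needed in summed form. Prefix sums suffice in [flow], because the bound
    derived from the tangents is nonincreasing in the offer; suffix sums suffice in [alpha_coef],
    because the budgets are nondecreasing. *)
Hypothesis flow : forall k, (k < t)%N ->
  \sum_(i < t | (i <= k)%N) o i <=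
  \sum_(l < t | (l < k)%N) w l * \sum_(j < t | (j <= l)%N) P j.
Hypothesis alpha_coef : forall k, (k < t)%N ->
  (t - k)%:R <= \sum_(l < t | (k <= l)%N) (w l * (cap l - l.+1)%:R + o l * u l).
Hypothesis cap_le : forall l, (l < t)%N -> (cap l <= t)%N.
Hypothesis dist_coef : forall j, (j < t)%N ->
  Q j * (\sum_(l < t | (j <= l)%N) w l) + \sum_(l < t | (l < j < cap l)%N) w l + o j * v j <= gc.

(** One value per offer replaces the choice of a tangent. As a maximum over later indices it
    decreases with [l], which is what summation by parts needs. *)
Let G l : R := \big[Num.max/0]_(i < t | (l < i)%N) T i.

Let G_ge0 l : 0 <= G l.
Proof. by apply: bigmax_ge_id. Qed.

Let G_nonincreasing l : G l.+1 <= G l.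
Proof. by apply: sub_bigmax => i; apply: ltnW. Qed.

Let offer_G (l : 'I_t) :
  \sum_(j < t | (j <= l)%N) (P j * G l - Q j * D j)
    + \sum_(j < t | (l < j < cap l)%N) (A l - D j) <= phi.
Proof.
(* The bound holds at 0 and at each later [T i], and a maximum is one of its arguments. *)
apply: (big_ind (fun g => \sum_(j < t | (j <= l)%N) (P j * g - Q j * D j) + _ <= phi)).
- by apply: offer; left.
- by move=> x y; rewrite /Num.max; case: ifP.
- by move=> i li; apply: offer; right; exists i.
Qed.

Let sum_oT_le :
  \sum_(l < t) o l * T l <= \sum_(l < t) w l * (\sum_(j < t | (j <= l)%N) P j) * G l.
Proof.
pose m (l : nat) := \sum_(j < t | (j <= l)%N) P j.
have m_ge0 l : 0 <= m l by apply: sumr_ge0.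
case: (posnP t) => [t0|t_gt0].
  by rewrite !big1 // => -[i lti]; exfalso; rewrite t0 in lti.
have tE : t = t.-1.+1 by rewrite prednK.
(* At [k = 0] the right side of [flow] is empty, so the first tangent has no weight. The indices can
   then be shifted, to compare [T i.+1] with [G i]. *)
have o0 : o 0 <= 0.
  have := flow t_gt0; rewrite [leRHS]big_pred0 // (bigD1 (Ordinal t_gt0)) //= big1 ?addr0 //.
  by move=> i /andP[+ /eqP ni]; rewrite leqn0 => /eqP i0; case: ni; apply: val_inj.
have {}o0 : o 0 = 0 by apply/le_anti; rewrite o0 o_ge0.
have H : 0 <= \sum_(i < t.-1) (w i * m i - o i.+1) * G i.
  apply: (@sum_mul_nonincreasing_ge0 R t.-1 (fun i => w i * m i - o i.+1) G) => // k lek.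
  have ltk : (k < t)%N by rewrite tE.
  rewrite sumrB subr_ge0; have := flow ltk.
  rewrite -(big_ord_widen t (fun l => w l * m l)) ?(ltnW ltk) //.
  rewrite (eq_bigl (fun i : 'I_t => (i < k.+1)%N)) // -(big_ord_widen t o) //.
  by rewrite big_ord_recl /= o0 add0r.
have -> : \sum_(l < t) o l * T l = \sum_(l < t.-1) o l.+1 * T l.+1.
  rewrite -(big_mkord xpredT (fun l => o l * T l)) -(big_mkord xpredT (fun l => o l.+1 * T l.+1)).
  by rewrite [in LHS]tE big_nat_recl // o0 mul0r add0r.
have H2 : \sum_(l < t.-1) o l.+1 * T l.+1 <= \sum_(l < t.-1) w l * m l * G l.
  move: H; under eq_bigr do rewrite mulrBl.
  rewrite sumrB subr_ge0; apply: le_trans; apply: ler_sum => i _.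
  have lti : (i.+1 < t)%N by case: i => i /=; lia.
  apply: ler_wpM2l => //; exact: (@le_bigmax_cond _ _ _ _ (Ordinal lti)).
apply: (le_trans H2).
rewrite -!(big_mkord xpredT (fun l => w l * m l * G l)) [t in leRHS]tE big_nat_recr //=.
by rewrite lerDl !mulr_ge0.
Qed.

(** Weak duality: the offers are summed with weights [w], their terms in [G] are traded for tangents
    by [sum_oT_le], and the resulting coefficients are compared with 1 for budgets (in suffix sums)
    and with [gc] for distances. *)
Lemma block_program_bound : \sum_(j < t) A j <= gf * phi + gc * \sum_(j < t) D j.
Proof.
pose m (l : nat) := \sum_(j < t | (j <= l)%N) P j.
have offers : \sum_(l < t) w l * (\sum_(j < t | (j <= l)%N) (P j * G l - Q j * D j)
    + \sum_(j < t | (l < j < cap l)%N) (A l - D j)) <= gf * phi.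
  apply: (@le_trans _ _ (\sum_(l < t) w l * phi)); last by rewrite -mulr_suml ler_wpM2r.
  by apply: ler_sum => l _; rewrite ler_wpM2l ?offer_G.
have split_offers : \sum_(l < t) w l * (\sum_(j < t | (j <= l)%N) (P j * G l - Q j * D j)
    + \sum_(j < t | (l < j < cap l)%N) (A l - D j))
  = \sum_(l < t) w l * m l * G l + \sum_(l < t) w l * (cap l - l.+1)%:R * A l
    - \sum_(j < t) (Q j * (\sum_(l < t | (j <= l)%N) w l)
          + \sum_(l < t | (l < j < cap l)%N) w l) * D j.
  have -> : \sum_(j < t) (Q j * (\sum_(l < t | (j <= l)%N) w l)
          + \sum_(l < t | (l < j < cap l)%N) w l) * D j =
      \sum_(l < t) w l * (\sum_(j < t | (j <= l)%N) Q j * D j + \sum_(j < t | (l < j < cap l)%N) D j).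
    under eq_bigr do rewrite mulrDl.
    under [RHS]eq_bigr do rewrite mulrDr.
    rewrite !big_split /=; congr (_ + _).
      under [RHS]eq_bigr do rewrite mulr_sumr big_mkcond.
      rewrite exchange_big /=; apply: eq_bigr => j _.
      rewrite mulrAC mulrC mulr_suml [LHS]big_mkcond; apply: eq_bigr => l _; by case: ifP.
    under [RHS]eq_bigr do rewrite mulr_sumr big_mkcond.
    rewrite exchange_big /=; apply: eq_bigr => j _.
    by rewrite mulr_suml [LHS]big_mkcond.
  rewrite -big_split -sumrB /=; apply: eq_bigr => l _.
  rewrite [X in _ * (X + _)]sumrB sumrB -/(m l) -mulr_suml -/(m l).
  rewrite (_ : \sum_(j < t | _) A l = (cap l - l.+1)%:R * A l); first by ring.
  by rewrite sum_ord_interval_const ?cap_le.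
have alpha : \sum_(j < t) A j <=
    \sum_(l < t) (w l * (cap l - l.+1)%:R + o l * u l) * A l.
  rewrite -subr_ge0 -sumrB.
  under eq_bigr do rewrite -{2}[A _]mul1r -mulrBl.
  apply: (@sum_mul_nondecreasing_ge0 _ t
    (fun l => w l * (cap l - l.+1)%:R + o l * u l - 1)) => // k ltk.
  rewrite sumrB subr_ge0 (le_trans _ (alpha_coef ltk)) //.
  rewrite (eq_bigl (fun i : 'I_t => (k <= i < t)%N)) ?sum_ord_interval_const ?mulr1 // => i.
  by rewrite ltn_ord andbT.
have dist : \sum_(j < t) (Q j * (\sum_(l < t | (j <= l)%N) w l)
          + \sum_(l < t | (l < j < cap l)%N) w l + o j * v j) * D j <= gc * \sum_(j < t) D j.
  by rewrite mulr_sumr; apply: ler_sum => j _; rewrite ler_wpM2r ?D_ge0 ?dist_coef.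
have oT : \sum_(l < t) o l * T l = \sum_(l < t) o l * u l * A l - \sum_(l < t) o l * v l * D l.
  by rewrite -sumrB; apply: eq_bigr => l _; rewrite /T mulrBr !mulrA.
have := sum_oT_le; rewrite oT -/(m _).
move: alpha dist offers; rewrite split_offers.
under [\sum_(l < t) (_ + o l * u l) * A l]eq_bigr do rewrite mulrDl.
under [\sum_(j < t) (_ + o j * v j) * D j]eq_bigr do rewrite mulrDl.
rewrite !big_split /=; lra.
Qed.

End BlockProgram.

(** * Star systems and block averages *)

Section Star.
Variable R : rcfType.
Implicit Types (a d : nat -> R) (r : nat -> nat -> R).

(** Both steps use [p * (a + b) ^+ 2 <= a ^+ 2 + p / (1 - p) * b ^+ 2], whose defect is a square
    once denominators are cleared: first with [p = u], [a = x + y], [b = z], then with [p = P],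
    [a = x], [b = y]. Since [1 / (1 - P) = 1 + P / (1 - P)], the slope [Q] also absorbs the
    subtracted [d]. *)
Lemma offer_tangent (P Q u v al r d d' : R) :
  0 <= al -> 0 <= r -> 0 <= d -> 0 <= d' ->
  Num.sqrt al <= Num.sqrt r + Num.sqrt d + Num.sqrt d' ->
  0 <= P -> 0 <= Q -> P = 0 \/ P < 1 /\ 1 <= (1 - P) * Q ->
  0 <= u < 1 -> u <= v * (1 - u) ->
  P * (u * al - v * d') - Q * d <= Num.max (r - d) 0.
Proof.
move=> al0 r0 d0 d'0.
set x := Num.sqrt r; set y := Num.sqrt d; set z := Num.sqrt d'.
have [x0 y0 z0] : [/\ 0 <= x, 0 <= y & 0 <= z] by rewrite !sqrtr_ge0.
have rE : r = x ^+ 2 by rewrite sqr_sqrtr.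
have dE : d = y ^+ 2 by rewrite sqr_sqrtr.
have d'E : d' = z ^+ 2 by rewrite sqr_sqrtr.
rewrite rE dE d'E => tri P0 Q0 PQ /andP[u0 u1] uv.
have alE : al <= (x + y + z) ^+ 2.
  by rewrite -[al]sqr_sqrtr // ler_pXn2r // nnegrE ?sqrtr_ge0 // !addr_ge0.
rewrite le_max; case: PQ => [->|[P1 PQ]].
  by apply/orP; right; rewrite mul0r sub0r oppr_le0 mulr_ge0 ?sqr_ge0.
apply/orP; left.
have step1 : u * al - v * z ^+ 2 <= (x + y) ^+ 2.
  apply: (@le_trans _ _ (u * (x + y + z) ^+ 2 - v * z ^+ 2)).
    by rewrite lerD2r ler_wpM2l.
  have : 0 <= ((1 - u) * (x + y) - u * z) ^+ 2 by rewrite sqr_ge0.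
  have : 0 <= (v * (1 - u) - u) * z ^+ 2 by rewrite mulr_ge0 ?sqr_ge0 ?subr_ge0.
  move=> H1 H2; rewrite -(ler_pM2l (_ : 0 < 1 - u)) ?subr_gt0 //.
  by rewrite -subr_ge0; move: (addr_ge0 H1 H2); congr (0 <= _); ring.
apply: (@le_trans _ _ (P * (x + y) ^+ 2 - Q * y ^+ 2)).
  by rewrite lerD2r ler_wpM2l.
have H1 : 0 <= ((1 - P) * x - P * y) ^+ 2 by rewrite sqr_ge0.
have H2 : 0 <= ((1 - P) * Q - 1) * y ^+ 2 by rewrite mulr_ge0 ?sqr_ge0 ?subr_ge0.
rewrite -(ler_pM2l (_ : 0 < 1 - P)) ?subr_gt0 // -subr_ge0.
by move: (addr_ge0 H1 H2); congr (0 <= _); ring.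
Qed.

(** The numerical content of one star, its cities numbered by time of connection: [a] are the
    budgets, [d] the distances to the facility, [phi] its opening cost, and [r m n] is the
    connection cost of [m] just before [n] connects. *)
Record star k a d r (phi : R) : Prop := Star {
  star_budget_ge0 : forall m, (m < k)%N -> 0 <= a m;
  star_dist_ge0 : forall m, (m < k)%N -> 0 <= d m;
  star_conn_ge0 : forall m n, (m <= n < k)%N -> 0 <= r m n;
  star_conn_diag : forall m, (m < k)%N -> r m m = a m;
  star_budget_sorted : forall m n, (m <= n < k)%N -> a m <= a n;
  star_offer : forall n, (n < k)%N ->
    \sum_(m < k) Num.max ((if (m <= n)%N then r m n else a n) - d m) 0 <= phi;
  star_triangle : forall m n n', (m <= n)%N -> (n <= n' < k)%N ->
    Num.sqrt (a n') <= Num.sqrt (r m n) + Num.sqrt (d m) + Num.sqrt (d n') }.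

(** Copy [i] belongs to city [i %/ t]. The [t * k] copies are cut into [t] blocks of [k] consecutive
    ones, whatever the divisibility of [k]; the copies of one city may spread over several
    blocks. *)
Definition block t k (g : nat -> R) (j : nat) : R :=
  \sum_(j * k <= i < j.+1 * k) g (i %/ t)%N.

Lemma sum_block t k (g : nat -> R) : (0 < t)%N ->
  \sum_(j < t) block t k g j = t%:R * \sum_(m < k) g m.
Proof.
move=> t0; rewrite -!(big_mkord xpredT) /block -big_nat_mul mulnC big_nat_mul mulr_sumr.
apply: eq_bigr => m _.
rewrite (eq_big_nat _ _ (F2 := fun=> g m)) => [|i /andP[mi im]].
  by rewrite sumr_const_nat -mulnBl subSnn mul1n mulr_natl.
by congr g; apply/eqP; rewrite eqn_leq leq_divRL // mi -ltnS ltn_divLR // im.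
Qed.

Section Blocks.
Variables (t k : nat) (a d : nat -> R) (r : nat -> nat -> R) (phi : R).
Hypotheses (t_gt0 : (0 < t)%N) (k_gt0 : (0 < k)%N) (st : star k a d r phi).
Let A := block t k a.
Let D := block t k d.

Lemma block_index_lt j i : (j < t)%N -> (j * k <= i < j.+1 * k)%N -> (i %/ t < k)%N.
Proof.
move=> jt /andP[_ ij]; rewrite ltn_divLR // (leq_trans ij) // mulnC leq_mul2l jt.
by rewrite orbT.
Qed.

Lemma block_sum_ge0 (g : nat -> R) j :
  (forall m, (m < k)%N -> 0 <= g m) -> (j < t)%N -> 0 <= block t k g j.
Proof.
move=> g0 jt; rewrite /block big_nat; apply: sumr_ge0 => i ij.
by apply: g0; apply: block_index_lt ij.
Qed.

Lemma block_const x (j : nat) : \sum_(j * k <= i < j.+1 * k) x = k%:R * x :> R.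
Proof. by rewrite sumr_const_nat -mulnBl subSnn mul1n mulr_natl. Qed.

Lemma block_sorted i j : (i <= j)%N -> (j < t)%N -> A i <= A j.
Proof.
move=> ij jt; rewrite /A /block.
rewrite -[(i * k)%N]add0n -[(j * k)%N]add0n !big_addn -!mulnBl !subSnn mul1n !big_mkord.
apply: ler_sum => q _; apply: (star_budget_sorted st); apply/andP; split.
  by apply: leq_div2r; rewrite leq_add2l leq_mul2r ij orbT.
apply: (block_index_lt jt); rewrite leq_addl mulSn /= ltn_add2r; exact: ltn_ord.
Qed.

(* The offers received by the facility are compared at the budget of the city
   carrying the last index of block [l]: the connection costs entering that
   offer are constrained by all cities of later blocks. *)
Lemma block_offer (P Q u v : nat -> R) (c : nat) (l : 'I_t) G :
  (forall i, 0 <= P i) -> (forall i, 0 <= Q i) ->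
  (forall i, (i < t)%N -> P i = 0 \/ P i < 1 /\ 1 <= (1 - P i) * Q i) ->
  (forall i, (i < t)%N -> 0 <= u i < 1 /\ u i <= v i * (1 - u i)) ->
  G = 0 \/ (exists2 i : 'I_t, (l < i)%N & G = u i * A i - v i * D i) ->
  \sum_(j < t | (j <= l)%N) (P j * G - Q j * D j)
    + \sum_(j < t | (l < j < c)%N) (A l - D j) <= t%:R * phi.
Proof.
move=> P0 Q0 PQ uv HG.
pose y := (l.+1 * k).-1; pose n := (y %/ t)%N.
have yE : y.+1 = (l.+1 * k)%N by rewrite /y prednK // muln_gt0.
have nk : (n < k)%N.
  apply: (@block_index_lt l) => //; move: yE k_gt0; rewrite mulSn; lia.
pose g m := Num.max ((if (m <= n)%N then r m n else a n) - d m) 0.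
have g0 m : 0 <= g m by rewrite le_max lexx orbT.
apply: (@le_trans _ _ (t%:R * \sum_(m < k) g m)); last first.
  by rewrite ler_wpM2l ?ler0n // (star_offer st).
rewrite -sum_block // [X in X + _]big_mkcond [X in _ + X]big_mkcond -big_split /=.
apply: ler_sum => j _; have jt := ltn_ord j.
case: leqP => [jl|lj] /=.
  rewrite addr0; have ile i : (j * k <= i < j.+1 * k)%N -> (i %/ t <= n)%N.
    move=> /andP[_ ij]; apply: leq_div2r; rewrite -ltnS yE (leq_trans ij) //.
    by rewrite leq_mul2r ltnS jl orbT.
  have -> : block t k g j = \sum_(j * k <= i < j.+1 * k) Num.max (r (i %/ t)%N n - d (i %/ t)%N) 0.
    by apply: eq_big_nat => i /ile il; rewrite /g il.
  have Dj0 : 0 <= D j by apply: block_sum_ge0 => //; apply: (star_dist_ge0 st).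
  case: HG => [->|[l' ll' ->]].
    rewrite mulr0 sub0r (@le_trans _ _ 0) ?oppr_le0 ?mulr_ge0 //.
    by apply: sumr_ge0 => i _; rewrite le_max lexx orbT.
  have l't := ltn_ord l'.
  (* After scaling by [k] the inequality is a sum over pairs of a copy in block [j] and a copy in
     block [l'], and [offer_tangent] applies to each pair. *)
  rewrite -(ler_pM2l (_ : 0 < k%:R)) ?ltr0n //.
  rewrite (_ : k%:R * (P j * (u l' * A l' - v l' * D l') - Q j * D j) =
    \sum_(j * k <= i < j.+1 * k) \sum_(l' * k <= i' < l'.+1 * k)
      (P j * (u l' * a (i' %/ t)%N - v l' * d (i' %/ t)%N) - Q j * d (i %/ t)%N)); last first.
    under eq_bigr do rewrite sumrB block_const -mulr_sumr sumrB -!mulr_sumr.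
    by rewrite sumrB block_const -!mulr_sumr /A /D /block; ring.
  rewrite mulr_sumr big_nat [leRHS]big_nat; apply: ler_sum => i ij.
  rewrite -(block_const _ l') big_nat [leRHS]big_nat; apply: ler_sum => i' il'.
  have nl' : (n <= i' %/ t)%N.
    apply: leq_div2r; rewrite -ltnS yE; move/andP: il' => [+ _].
    by move/(leq_trans _)=> H; apply/leqW/H; rewrite leq_mul2r ll' orbT.
  have i'k := block_index_lt l't il'; have ik := block_index_lt jt ij.
  have [u01 uvl'] := uv _ l't.
  apply: offer_tangent => //.
  - exact: (star_budget_ge0 st).
  - by apply: (star_conn_ge0 st); rewrite ile.
  - exact: (star_dist_ge0 st).
  - exact: (star_dist_ge0 st).
  - by apply: (star_triangle st); rewrite ?ile ?nl'.
  - exact: PQ.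
rewrite add0r; case: ifP => _; last by apply: sumr_ge0.
rewrite /A /D /block -[X in X - _]mul1r.
apply: (@le_trans _ _ (\sum_(j * k <= i < j.+1 * k) (a n - d (i %/ t)%N))).
  rewrite sumrB lerD2r block_const -(block_const _ l) mul1r big_nat [leRHS]big_nat.
  apply: ler_sum => i /andP[_ il]; apply: (star_budget_sorted st).
  by rewrite nk andbT; apply: leq_div2r; rewrite -ltnS yE.
rewrite big_nat [leRHS]big_nat; apply: ler_sum => i /andP[ji _].
(* A copy in a later block whose city has index at most [n] belongs to city [n] itself, cut by the
   block boundary; there [r n n = a n]. *)
rewrite /g le_max; case: leqP => [iln|]; last by rewrite lexx.
have -> : (i %/ t)%N = n; last by rewrite (star_conn_diag st) ?lexx.
have jn : (j * k <= i)%N -> (n <= i %/ t)%N.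
  move=> H; apply: leq_div2r; rewrite -ltnS yE; apply: leqW; apply: leq_trans H.
  by rewrite leq_mul2r lj orbT.
by apply/eqP; rewrite eqn_leq iln jn.
Qed.

End Blocks.
End Star.

(** * The dual certificate *)

(** All prefix sums come from one pass, so each inequality of the checker only looks entries up;
    entry [k] has [k] terms. *)
Fixpoint partial_sums (g : nat -> N) (i n : nat) (acc : N) : seq N :=
  acc :: if n is m.+1 then partial_sums g i.+1 m (acc + g i)%num else [::].

(* The checker works with natural numbers: weights are scaled by [10 ^ 6] and
   slopes by [10 ^ 4]. The first [early] offers ignore the blocks from [late] on.
   The slopes [QN] and [vN] are the least ones allowed by [PN] and [uN], up to
   rounding. *)
Section Checker.
Local Open Scope N_scope.
Variables (t early late : nat) (wN oN PN uN : nat -> N).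

Definition cap (l : nat) : nat := if (l < early)%N then late else t.

Definition sums (g : nat -> N) : seq N := partial_sums g 0 t 0.

Definition QN (j : nat) : N :=
  if PN j == 0 then 0 else N.div (10 ^ 8) (10 ^ 4 - PN j) + 1.

Definition vN (l : nat) : N :=
  if uN l == 0 then 0 else N.div (10 ^ 4 * uN l) (10 ^ 4 - uN l) + 1.

Definition conn_slope_ok (i : nat) : bool :=
  (PN i == 0) || (PN i <? 10 ^ 4) && (10 ^ 8 + PN i * QN i <=? 10 ^ 4 * QN i).

Definition budget_slope_ok (i : nat) : bool :=
  (uN i <? 10 ^ 4) && (10 ^ 4 * uN i + vN i * uN i <=? 10 ^ 4 * vN i).

Definition budget_term (l : nat) : N :=
  10 ^ 4 * (wN l * N.of_nat (cap l - l.+1)) + oN l * uN l.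

Definition flow_ok (Os Fs : seq N) (k : nat) : bool :=
  10 ^ 4 * nth 0 Os k.+1 <=? nth 0 Fs k.

Definition budget_ok (Bs : seq N) (k : nat) : bool :=
  10 ^ 10 * N.of_nat (t - k) + nth 0 Bs k <=? nth 0 Bs t.

(** At scale [10 ^ 10] the constant is 3.4035. Negative terms are moved to the right because
    subtraction in [N] truncates; the last one discounts the early offers, which ignore block [j]
    once [late <= j]. *)
Definition dist_ok (Ws : seq N) (j : nat) : bool :=
  QN j * nth 0 Ws t + 10 ^ 4 * nth 0 Ws j + oN j * vN j
  <=? (34 * 10 ^ 3 + 35) * 10 ^ 6 + QN j * nth 0 Ws j
        + (if (j < late)%N then 0 else 10 ^ 4 * nth 0 Ws early).

Definition checks (Ws Os Fs Bs : seq N) : bool :=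
  (nth 0 Ws t <=? 145 * 10 ^ 4) &&
  all (fun i => [&& conn_slope_ok i, budget_slope_ok i, flow_ok Os Fs i,
    budget_ok Bs i & dist_ok Ws i]) (iota 0 t).

Definition certificate_ok : bool :=
  let Ps := sums PN in
  [&& (0 < t)%N, (early <= late <= t)%N &
    checks (sums wN) (sums oN) (sums (fun l => wN l * nth 0 Ps l.+1)) (sums budget_term)].

Local Close Scope N_scope.
Hypothesis ok : certificate_ok.
Variable R : rcfType.
Definition NR (n : N) : R := (N.to_nat n)%:R.
Arguments NR n%_num.

Lemma NR_le (m n : N) : (m <=? n)%num -> NR m <= NR n.
Proof. by rewrite /NR ler_nat; lia. Qed.

Lemma NR_ge0 (n : N) : 0 <= NR n.
Proof. exact: ler0n. Qed.

Lemma NRD (m n : N) : NR (m + n)%num = NR m + NR n.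
Proof. by rewrite /NR N2Nat.inj_add natrD. Qed.

Lemma NRM (m n : N) : NR (m * n)%num = NR m * NR n.
Proof. by rewrite /NR N2Nat.inj_mul natrM. Qed.

Lemma NR_of_nat (n : nat) : NR (N.of_nat n) = n%:R.
Proof. by rewrite /NR Nat2N.id. Qed.

Lemma NR_pow10 (n : nat) : NR (10 ^ N.of_nat n)%num = 10 ^+ n.
Proof.
rewrite /NR -natrX; congr _%:R; elim: n => [//|n IH].
by rewrite Nat2N.inj_succ N.pow_succ_r' N2Nat.inj_mul IH expnS.
Qed.

Lemma NR_partial_sums (g : nat -> N) i n acc k : (k <= n)%N ->
  NR (nth 0%num (partial_sums g i n acc) k) = NR acc + \sum_(j < k) NR (g (i + j)%N).
Proof.
elim: n i acc k => [|n IH] i acc [|k] //=; rewrite ?big_ord0 ?addr0 //.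
move=> kn; rewrite IH // NRD big_ord_recl addn0 addrA; congr (_ + _).
by apply: eq_bigr => j _; rewrite addSnnS.
Qed.

Lemma NR_sums (g : nat -> N) k : (k <= t)%N ->
  NR (nth 0%num (sums g) k) = \sum_(j < t | (j < k)%N) NR (g j).
Proof.
move=> kt; rewrite NR_partial_sums // add0r.
exact: (big_ord_widen t (fun j => NR (g j))).
Qed.

Lemma NR_sums_all (g : nat -> N) : NR (nth 0%num (sums g) t) = \sum_(j < t) NR (g j).
Proof. by rewrite NR_sums //; apply: eq_bigl => j; rewrite ltn_ord. Qed.

Lemma NR_sums_from (g : nat -> N) k : (k <= t)%N ->
  \sum_(j < t | (k <= j)%N) NR (g j) = NR (nth 0%num (sums g) t) - NR (nth 0%num (sums g) k).
Proof.
move=> kt; rewrite NR_sums_all NR_sums // [X in X - _](bigID (fun j : 'I_t => (j < k)%N)) /=.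
by rewrite addrAC subrr add0r; apply: eq_bigl => j; rewrite -leqNgt.
Qed.

Let w i : R := NR (wN i) / 10 ^+ 6.
Let o i : R := NR (oN i) / 10 ^+ 6.
Let P i : R := NR (PN i) / 10 ^+ 4.
Let Q i : R := NR (QN i) / 10 ^+ 4.
Let u i : R := NR (uN i) / 10 ^+ 4.
Let v i : R := NR (vN i) / 10 ^+ 4.

Let t_gt0 : (0 < t)%N.
Proof. by have /and3P[] := ok. Qed.

Let early_late_t : (early <= late <= t)%N.
Proof. by have /and3P[] := ok. Qed.

Let ok_at i : (i < t)%N -> [&& conn_slope_ok i, budget_slope_ok i,
  flow_ok (sums oN) (sums (fun l => wN l * nth 0 (sums PN) l.+1)%num) i,
  budget_ok (sums budget_term) i & dist_ok (sums wN) i].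
Proof.
move=> lti; have /and3P[_ _ /andP[_ /allP]] := ok; apply.
by rewrite mem_iota.
Qed.

Let capped_weight j : (j < t)%N ->
  \sum_(l < t | (l < j < cap l)%N) NR (wN l) = NR (nth 0%num (sums wN) j) -
    (if (j < late)%N then 0 else NR (nth 0%num (sums wN) early)).
Proof.
move=> jt; have /andP[el lt] := early_late_t.
rewrite NR_sums ?(ltnW jt) //; case: ltnP => jl.
  rewrite subr0; apply: eq_bigl => i; rewrite /cap; case: ifP => _; rewrite ?jl ?jt andbT //.
rewrite NR_sums ?(leq_trans el) // [in RHS](bigID (fun i : 'I_t => (i < early)%N)) /=.
rewrite [X in X + _ - _](eq_bigl (fun i : 'I_t => (i < early)%N)) => [|i]; last first.
  by apply/andb_idl => ie; apply: leq_trans ie (leq_trans el jl).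
rewrite addrAC subrr add0r; apply: eq_bigl => i; rewrite /cap; case: ifP => _ /=.
  by rewrite [(j < late)%N]ltnNge jl !andbF.
by rewrite jt andbT.
Qed.

Let conn_slope i : (i < t)%N -> P i = 0 \/ P i < 1 /\ 1 <= (1 - P i) * Q i.
Proof.
move=> /ok_at/andP[/orP[/eqP P0 _|/andP[P1 PQ] _]].
  by left; rewrite /P P0 mul0r.
right; split.
  have : NR (PN i) < 10 ^+ 4 by rewrite -(NR_pow10 4) /NR ltr_nat; lia.
  rewrite /P; lra.
have := NR_le PQ; rewrite NRD !NRM (NR_pow10 8) (NR_pow10 4) /P /Q; lra.
Qed.

Let budget_slope i : (i < t)%N -> 0 <= u i < 1 /\ u i <= v i * (1 - u i).
Proof.
move=> /ok_at/and3P[_ /andP[u1 uv] _].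
have : NR (uN i) < 10 ^+ 4 by rewrite -(NR_pow10 4) /NR ltr_nat; lia.
have u0 := NR_ge0 (uN i).
have := NR_le uv; rewrite NRD !NRM (NR_pow10 4) /u /v => H1 H2.
split; [lra|nra].
Qed.

Lemma certified_star_bound k a d r (phi : R) : 0 <= phi -> star k a d r phi ->
  \sum_(m < k) a m <= 29 / 20 * phi + 6807 / 2000 * \sum_(m < k) d m.
Proof.
move=> phi0 st; case: (posnP k) => [->|k0].
  by rewrite !big_ord0 mulr0 addr0 mulr_ge0 ?divr_ge0 ?ler0n.
have tR : 0 < t%:R :> R by rewrite ltr0n.
(* The block program counts every city [t] times and therefore runs with opening cost [t%:R * phi];
   the factor cancels. *)
rewrite -(ler_pM2l tR) mulrDr !(mulrCA t%:R) -!sum_block //.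
have ge0 x n : 0 <= NR x / 10 ^+ n by rewrite divr_ge0 ?exprn_ge0 ?NR_ge0.
have c4 : 10 ^+ 4 != 0 :> R by rewrite expf_neq0 ?pnatr_eq0.
have c6 : 10 ^+ 6 != 0 :> R by rewrite expf_neq0 ?pnatr_eq0.
have w0 i : 0 <= w i by apply: ge0.
have o0 i : 0 <= o i by apply: ge0.
have P0 i : 0 <= P i by apply: ge0.
have Q0 i : 0 <= Q i by apply: ge0.
apply: (@block_program_bound R t cap w o P Q u v) => //.
- by move=> i it; apply: block_sum_ge0 it => //; apply: (star_budget_ge0 st).
- by move=> i it; apply: block_sum_ge0 it => //; apply: (star_dist_ge0 st).
- by rewrite mulr_ge0 ?ler0n.
- by move=> i j ij jt; exact: (block_sorted t_gt0 st ij jt).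
- by move=> l G; apply: (block_offer _ _ st).
- have /and3P[_ _ /andP[/NR_le + _]] := ok.
  rewrite NR_sums_all NRM (NR_pow10 4) -[145%num]/(N.of_nat 145) NR_of_nat => H.
  by rewrite -mulr_suml; move: H; set X := \sum_(_ < _ | _) _; lra.
- move=> l lt; have /and5P[_ _ /NR_le + _ _] := ok_at lt.
  rewrite NRM !NR_sums ?(ltnW lt) // (NR_pow10 4) => H; rewrite -mulr_suml.
  rewrite (_ : \sum_(i < t | (i < l)%N) _ = (\sum_(i < t | (i < l)%N)
    NR (wN i * nth 0 (sums PN) i.+1)%num) / 10 ^+ 6 / 10 ^+ 4).
    by rewrite ler_pdivlMr ?exprn_gt0 ?ltr0n // mulrAC ler_wpM2r ?invr_ge0 ?exprn_ge0 ?ler0n // mulrC.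
  rewrite !mulr_suml; apply: eq_bigr => i _.
  by rewrite NRM NR_sums // /w /P -mulr_suml; field.
- move=> l lt; have /and5P[_ _ _ /NR_le + _] := ok_at lt.
  rewrite NRD -lerBrDr -NR_sums_from ?(ltnW lt) // NRM (NR_pow10 10) NR_of_nat => H.
  rewrite (_ : \sum_(i < t | _) _ = (\sum_(i < t | (l <= i)%N) NR (budget_term i)) / 10 ^+ 10).
    by rewrite ler_pdivlMr ?exprn_gt0 ?ltr0n // mulrC.
  rewrite mulr_suml; apply: eq_bigr => i _.
  by rewrite NRD !NRM NR_of_nat (NR_pow10 4) /w /o /u; field.
- by move=> l lt; rewrite /cap; case: ifP => // _; case/andP: early_late_t.
- move=> j lt; have /and5P[_ _ _ _ /NR_le] := ok_at lt.
  rewrite -!mulr_suml NR_sums_from ?(ltnW lt) // capped_weight //.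
  rewrite 4!NRD 5!NRM (NR_pow10 4) /o /v /Q.
  rewrite NRD NRM (NR_pow10 3) (NR_pow10 6) -[34%num]/(N.of_nat 34) -[35%num]/(N.of_nat 35) !NR_of_nat.
  have NR0 : NR 0 = 0 by [].
  by case: ifP => _; rewrite ?NRM ?(NR_pow10 4) ?NR0; lra.
Qed.

End Checker.

Local Open Scope N_scope.

(* A rounded numerical optimum of the dual of the block program with 200 blocks;
   the value 3.4035 leaves a slack of about 0.0006. *)
Definition offer_weights : seq N := [::
  5747; 5780; 5814; 5848; 5883; 5917; 5952; 5988; 6024; 6061; 6098; 6135;
  6172; 6212; 6250; 6289; 6329; 5616; 6178; 5556; 5586; 5618; 5650; 5682;
  5714; 5747; 5781; 5814; 5848; 5882; 5917; 5953; 5988; 6024; 6060; 6098;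
  6135; 6173; 6211; 6250; 6289; 6329; 6370; 6410; 6452; 6493; 6536; 6579;
  6622; 6667; 6712; 6756; 6803; 6849; 6897; 6944; 6993; 7043; 7092; 7143;
  7194; 7246; 7300; 7352; 7408; 7463; 7518; 7576; 7634; 7692; 7752; 7812;
  7874; 7937; 8000; 8064; 8131; 8196; 8265; 8333; 8403; 8475; 8547; 8621;
  8695; 8772; 8850; 8928; 9009; 9091; 9175; 9259; 9346; 9434; 9523; 9616;
  9709; 9804; 9901; 10000; 10101; 10204; 10309; 10417; 10526; 10638; 10753;
  10869; 10989; 11112; 11235; 11364; 11494; 11628; 11765; 11905; 12048;
  12195; 12346; 12500; 12656; 12695; 12987; 12889; 12491; 12441; 12377;
  12316; 12252; 12165; 12103; 12020; 11940; 11830; 11744; 11673; 11557;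
  11473; 11366; 11287; 11174; 11067; 10918; 10795; 10717; 10583; 10422;
  10282; 10138; 10008; 9843; 9670; 9468; 9347; 9141; 8931; 8734; 8496; 8291;
  8046; 6543; 6426; 6240; 6088; 5957; 5767; 5595; 5344; 5103; 4890; 4601;
  4220; 3893; 3553; 3026; 157].

Definition target_weights : seq N := nseq 121 0%num ++ [::
  11807; 0; 24947; 77594; 97464; 118976; 140251; 161878; 185626; 206850;
  230228; 253534; 279556; 303446; 325610; 352605; 376287; 401839; 424947;
  451574; 477515; 507750; 535549; 558763; 587638; 619089; 648614; 678528;
  706991; 739282; 771634; 807629; 835336; 871585; 908213; 943395; 982813;
  1018935; 1059125; 1176503; 1206383; 1243144; 1276491; 1307827; 1344824;
  1379877; 1422166; 1463263; 1501214; 1545776; 1598142; 1644405; 1690779;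
  1752653; 1900148; 1930689; 1945432; 1944654; 1944654; 1944654; 1944654;
  1944654; 1944654; 1944654; 1941543; 1943097; 1937660; 1945432; 1945433;
  1945432; 1945432; 1944654; 1944654; 1945432; 1945433; 1945432; 1946211;
  1945432; 1943877].

Definition conn_slopes : seq N := [::
  5738; 5747; 5757; 5767; 5777; 5787; 5797; 5807; 5818; 5828; 5839; 5850;
  5860; 5871; 5882; 5893; 5904; 5916; 5927; 5937; 5947; 5957; 5967; 5978;
  5988; 5999; 6009; 6020; 6031; 6042; 6053; 6064; 6075; 6087; 6098; 6110;
  6121; 6133; 6145; 6157; 6169; 6181; 6194; 6206; 6219; 6232; 6245; 6258;
  6271; 6285; 6298; 6312; 6326; 6339; 6354; 6368; 6382; 6397; 6412; 6427;
  6442; 6457; 6473; 6488; 6504; 6520; 6537; 6553; 6570; 6587; 6604; 6621;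
  6639; 6657; 6675; 6693; 6712; 6731; 6750; 6769; 6789; 6809; 6829; 6849;
  6870; 6891; 6912; 6934; 6956; 6979; 7001; 7025; 7048; 7072; 7096; 7121;
  7146; 7171; 7197; 7224; 7251; 7278; 7306; 7334; 7363; 7392; 7422; 7452;
  7483; 7515; 7547; 7580; 7614; 7648; 7683; 7719; 7756; 7793; 7831; 7870;
  7910; 7901; 7870; 7816; 7764; 7714; 7664; 7615; 7567; 7505; 7448; 7387;
  7329; 7254; 7195; 7124; 7054; 6985; 6895; 6820; 6735; 6651; 6554; 6473;
  6380; 6286; 6174; 6075; 5962; 5850; 5737; 5586; 5468; 5329; 5189; 5044;
  4881; 4729; 4560; 4408].

Definition budget_slopes : seq N := nseq 121 0%num ++ [::
  8333; 0; 8174; 8141; 8143; 8110; 8076; 8036; 7998; 7972; 7932; 7889; 7843;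
  7797; 7768; 7712; 7672; 7632; 7595; 7546; 7499; 7439; 7384; 7348; 7292;
  7231; 7174; 7118; 7066; 7003; 6944; 6872; 6824; 6754; 6684; 6619; 6544;
  6478; 6403; 6331; 6265; 6187; 6117; 6052; 5978; 5909; 5829; 5753; 5684;
  5606; 5518; 5442; 5368; 5274; 5203; 5163; 5144; 5145; 5145; 5145; 5145;
  5145; 5145; 5145; 5149; 5147; 5154; 5144; 5144; 5144; 5144; 5145; 5145;
  5144; 5144; 5144; 5143; 5144; 5146].

Local Close Scope N_scope.

Definition seq_fun (s : seq N) (i : nat) : N := nth 0%num s i.

Lemma certificate : certificate_ok 200 18 175 (seq_fun offer_weights)
  (seq_fun target_weights) (seq_fun conn_slopes) (seq_fun budget_slopes).
Proof. vm_cast_no_check (erefl true). Qed.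

Lemma star_bound (R : rcfType) k a d r (phi : R) : 0 <= phi -> star k a d r phi ->
  \sum_(m < k) a m <= 29 / 20 * phi + 6807 / 2000 * \sum_(m < k) d m.
Proof. exact: (certified_star_bound certificate). Qed.

(** * Runs of the first phase *)

Section FirstTime.
Variable R : realType.

(** The time is the infimum of those where [g] has reached [phi]. The Lipschitz bound plays the part
    of continuity and excludes a jump across [phi] there. *)
Lemma first_hitting_time (g : R -> R) (a b phi K : R) :
  0 <= K -> a <= b -> g a <= phi <= g b ->
  (forall s s', a <= s -> s <= s' -> g s <= g s') ->
  (forall s s', a <= s -> s <= s' -> g s' <= g s + K * (s' - s)) ->
  exists2 s, a <= s & g s = phi /\ forall s', a <= s' -> g s' = phi -> s <= s'.
Proof.
move=> K0 ab /andP[ga gb] mono lip.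
pose E : classical_sets.set R := fun s => a <= s /\ phi <= g s.
have Eb : E b by [].
have lbE : classical_sets.lbound E a by move=> s [].
have infE : classical_sets.has_inf E by split; [exists b | exists a].
have aT : a <= inf E by apply: lb_le_inf => //; exists b.
have least s : E s -> inf E <= s by move=> Es; apply: ge_inf => //; exists a.
have hit : phi <= g (inf E).
  rewrite leNgt; apply/negP => lt.
  (* Dividing by [K + 1] instead of [K] covers [K = 0]. *)
  have K1 : 0 < K + 1 by lra.
  have e0 : 0 < (phi - g (inf E)) / (K + 1) by rewrite divr_gt0 // subr_gt0.
  have [s Es ltse] := inf_adherent e0 infE.
  have := lip _ _ aT (least _ Es); have [_ gs] := Es.
  suff : K * (s - inf E) < phi - g (inf E) by lra.
  have : s - inf E < (phi - g (inf E)) / (K + 1) by lra.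
  rewrite ltr_pdivlMr // => H.
  have : 0 <= s - inf E by rewrite subr_ge0 least.
  nra.
exists (inf E) => //; split; last by move=> s' as' gs'; apply: least; split; rewrite ?gs'.
apply/le_anti; rewrite hit andbT leNgt; apply/negP => lt.
have K1 : 0 < K + 1 by lra.
(* Were [g] above [phi] at the infimum, this earlier time, kept at or after [a], would already
   belong to [E]. *)
pose s := Num.max a (inf E - (g (inf E) - phi) / (K + 1)).
have as_ : a <= s by rewrite le_max lexx.
have aT' : a < inf E.
  by rewrite lt_neqAle aT andbT; apply: contraTneq lt => <-; rewrite -leNgt.
have e0 : 0 < (g (inf E) - phi) / (K + 1) by rewrite divr_gt0 // subr_gt0.
have sT : s < inf E by rewrite gt_max aT' /=; lra.
have := lip _ _ as_ (ltW sT).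
have : inf E - s <= (g (inf E) - phi) / (K + 1).
  have : inf E - (g (inf E) - phi) / (K + 1) <= s by rewrite le_max lexx orbT.
  lra.
rewrite ler_pdivlMr // => H1 H2.
have dT : 0 <= inf E - s by lra.
have gs : phi <= g s by nra.
by have := least s (conj as_ gs); lra.
Qed.

End FirstTime.

Section A2Invariant.
Variables (R : realType) (C F : finType) (c : F -> C -> R) (f : F -> R).
Hypothesis c_ge0 : forall i j, 0 <= c i j.
Hypothesis f_ge0 : forall i, 0 <= f i.
Hypothesis c_sqm : squared_metric c.
Implicit Types (st : A2state R C F) (i : F) (j l : C) (ord : seq C).

Definition conn_dist st j : R := if st_conn st j is Some i then c i j else 0.

Lemma city_offer_ge0 st s j i : 0 <= city_offer c st s j i.
Proof. by rewrite /city_offer; case: st_conn => [i'|]; rewrite le_max lexx orbT. Qed.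

(** Connected and unconnected cities become alike: each has a current price, its connection cost or
    the common budget, and offers the excess over [c i j]. *)
Lemma city_offerE st s j i :
  city_offer c st s j i = Num.max ((if unconnected st j then s else conn_dist st j) - c i j) 0.
Proof. by rewrite /city_offer /unconnected /conn_dist; case: st_conn. Qed.

Lemma city_offer_mono st s s' j i : s <= s' -> city_offer c st s j i <= city_offer c st s' j i.
Proof.
move=> ss; rewrite !city_offerE; case: ifP => // _.
by rewrite ge_max !le_max lexx orbT andbT lerD2r ss.
Qed.

Lemma total_offer_mono st s s' i : s <= s' -> total_offer c st s i <= total_offer c st s' i.
Proof. by move=> ss; apply: ler_sum => j _; apply: city_offer_mono. Qed.

Lemma total_offer_lipschitz st s s' i : s <= s' ->
  total_offer c st s' i <= total_offer c st s i + #|C|%:R * (s' - s).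
Proof.
move=> ss; rewrite mulr_natl -sumr_const -big_split /=; apply: ler_sum => j _.
rewrite !city_offerE; case: ifP => _; last by rewrite lerDl subr_ge0.
rewrite ge_max; apply/andP; split.
  by rewrite -lerBlDr le_max; apply/orP; left; lra.
by rewrite addr_ge0 ?subr_ge0 // le_max lexx orbT.
Qed.

Lemma first_payment st i : (exists j, unconnected st j) ->
  total_offer c st (st_time st) i <= f i ->
  exists2 s, st_time st <= s & total_offer c st s i = f i /\
    forall s', st_time st <= s' -> total_offer c st s' i = f i -> s <= s'.
Proof.
move=> [j uj] le.
(* From time [c i j + f i] on, the unconnected city [j] alone pays for [i]. *)
pose b := Num.max (st_time st) (c i j + f i).
apply: (@first_hitting_time _ (fun s => total_offer c st s i) _ b _ #|C|%:R) => //.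
- by rewrite le_max lexx.
- rewrite le /= /total_offer (bigD1 j) //= (@le_trans _ _ (city_offer c st b j i)) //.
    rewrite city_offerE uj le_max; apply/orP; left.
    have : c i j + f i <= b by rewrite le_max lexx orbT.
    lra.
  by rewrite lerDl sumr_ge0 // => k _; apply: city_offer_ge0.
- by move=> s s' _; apply: total_offer_mono.
- by move=> s s' _; apply: total_offer_lipschitz.
Qed.

(* [ord] lists the connected cities by order of connection, [al] records the
   budget of each city when it was connected, and [r j l] the connection cost of
   [j] just before [l] was connected ([al l] if [j] was not connected yet).
   Cities outside [ord] have index [size ord], hence come after those in [ord]. *)
Record star_history ord (al : C -> R) (r : C -> C -> R) : Prop := StarHistory {
  history_uniq : uniq ord;
  history_ge0 : forall j, j \in ord -> 0 <= al j;
  history_sorted : forall j l, l \in ord -> (index j ord <= index l ord)%N -> al j <= al l;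
  history_diag : forall j, j \in ord -> r j j = al j;
  history_r_ge0 : forall j l, l \in ord -> (index j ord <= index l ord)%N -> 0 <= r j l;
  history_offer : forall l i, l \in ord ->
    \sum_j Num.max ((if (index j ord <= index l ord)%N then r j l else al l) - c i j) 0 <= f i;
  history_triangle : forall i j l l', l' \in ord ->
    (index j ord <= index l ord <= index l' ord)%N ->
    Num.sqrt (al l') <= Num.sqrt (r j l) + Num.sqrt (c i j) + Num.sqrt (c i l') }.

(** Besides the history, three facts are carried along: no event is overdue ([inv_wait],
    [inv_offer_le]), the budgets of connected cities pay exactly for open facilities and current
    connections ([inv_paid]), and connection costs have only dropped since they were recorded
    ([inv_r_ge]). *)
Record A2inv st ord (al : C -> R) (r : C -> C -> R) : Prop := A2Inv {
  inv_history :> star_history ord al r;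
  inv_time : 0 <= st_time st;
  inv_ord : forall j, (j \in ord) = ~~ unconnected st j;
  inv_open : forall j i, st_conn st j = Some i -> i \in st_open st;
  inv_best : forall j i, ~~ unconnected st j -> i \in st_open st -> conn_dist st j <= c i j;
  inv_wait : forall j i, unconnected st j -> i \in st_open st -> st_time st <= c i j;
  inv_offer_le : forall i, i \notin st_open st -> total_offer c st (st_time st) i <= f i;
  inv_paid : \sum_(i in st_open st) f i = \sum_(j | ~~ unconnected st j) (al j - conn_dist st j);
  inv_al_le : forall j, j \in ord -> al j <= st_time st;
  inv_r_ge : forall j l, l \in ord -> (index j ord <= index l ord)%N -> conn_dist st j <= r j l }.

Lemma conn_dist_ge0 st j : 0 <= conn_dist st j.
Proof. by rewrite /conn_dist; case: st_conn. Qed.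

Lemma A2inv_init : A2inv (A2init R C F) [::] (fun _ => 0) (fun _ _ => 0).
Proof.
split=> //=.
- move=> i _; rewrite /total_offer big1 // => j _.
  by rewrite city_offerE /= sub0r; apply/max_idPr; rewrite oppr_le0.
- by rewrite big_set0 big_pred0.
Qed.

Section Step.
Variables (st : A2state R C F) (ord : seq C) (al : C -> R) (r : C -> C -> R) (t' : R).
Hypothesis inv : A2inv st ord al r.
Hypothesis time_le : st_time st <= t'.
Hypothesis offer_le : forall i, i \notin st_open st -> total_offer c st t' i <= f i.
Hypothesis wait : forall j i, unconnected st j -> i \in st_open st -> t' <= c i j.
Variable new : seq C.
Hypothesis new_uniq : uniq new.
Hypothesis new_unconnected : forall j, j \in new -> unconnected st j.

(** Both kinds of event extend the history alike: the cities of [new] connect with budget [t'], and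
    the costs recorded for them are the prices just before the event. *)
Definition step_al j : R := if j \in new then t' else al j.
Definition step_r j l : R :=
  if l \in new then (if unconnected st j then t' else conn_dist st j) else r j l.

Let new_notin j : j \in new -> j \notin ord.
Proof. by rewrite (inv_ord inv) negbK; apply: new_unconnected. Qed.

Let index_old j : j \in ord -> index j (ord ++ new) = index j ord.
Proof. by rewrite index_cat => ->. Qed.

Let index_le_old j l : l \in ord ->
  (index j (ord ++ new) <= index l (ord ++ new))%N = (index j ord <= index l ord)%N.
Proof.
move=> lo; rewrite (index_old lo) index_cat; case: ifP => // jo.
have lt : (index l ord < size ord)%N by rewrite index_mem.
have lt' : (index l ord < size ord + index j new)%N := leq_trans lt (leq_addr _ _).
by rewrite (memNindex (negbT jo)) leqNgt lt' [RHS]leqNgt lt.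
Qed.

Let index_le_mem j l : l \in ord -> (index j ord <= index l ord)%N -> j \in ord.
Proof. by rewrite -!index_mem => lo jl; apply: leq_ltn_trans jl lo. Qed.

Let t'_ge0 : 0 <= t'.
Proof. exact: le_trans (inv_time inv) time_le. Qed.

Let step_al_le j : j \in ord ++ new -> step_al j <= t'.
Proof.
rewrite mem_cat /step_al; case: ifP => // _; rewrite orbF => jo.
exact: le_trans (inv_al_le inv jo) time_le.
Qed.

Let al_old j : j \in ord -> step_al j = al j.
Proof. by move=> jo; rewrite /step_al; case: ifP => // /new_notin; rewrite jo. Qed.

Let r_old j l : l \in ord -> step_r j l = r j l.
Proof. by move=> lo; rewrite /step_r; case: ifP => // /new_notin; rewrite lo. Qed.

Let index_new j l : l \in new -> (index l (ord ++ new) < index j (ord ++ new))%N -> unconnected st j.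
Proof.
move=> ln; rewrite !index_cat (negbTE (new_notin ln)).
case: ifP => jo; last by move=> _; move: jo; rewrite (inv_ord inv) => /negbFE.
move: jo; rewrite -index_mem => jo lt; have := leq_ltn_trans (leq_addr _ _) (ltn_trans lt jo).
by rewrite ltnn.
Qed.

Lemma step_history : star_history (ord ++ new) step_al step_r.
Proof.
have H := inv_history inv; split.
- rewrite cat_uniq (history_uniq H) new_uniq andbT; apply/hasPn => j; exact: new_notin.
- by move=> j; rewrite mem_cat /step_al; case: ifP => [//|_]; rewrite orbF; apply: (history_ge0 H).
- move=> j l; rewrite mem_cat => /orP[lo|ln] jl.
    rewrite (index_le_old _ lo) in jl; have jo := index_le_mem lo jl.
    by rewrite !al_old // (history_sorted H).
  have [jo|] := boolP (j \in ord ++ new); first by rewrite {2}/step_al ln step_al_le.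
  move=> jo; move: jl; rewrite (memNindex jo) leqNgt index_mem mem_cat ln orbT //.
- move=> j; rewrite mem_cat => /orP[jo|jn].
    by rewrite r_old // al_old // (history_diag H).
  by rewrite /step_r /step_al jn new_unconnected.
- move=> j l; rewrite mem_cat => /orP[lo|ln] jl.
    by rewrite r_old // (history_r_ge0 H) // -index_le_old.
  by rewrite /step_r ln; case: ifP => // _; apply: conn_dist_ge0.
- move=> l i; rewrite mem_cat => /orP[lo|ln].
    rewrite (eq_bigr (fun j => Num.max ((if (index j ord <= index l ord)%N
      then r j l else al l) - c i j) 0)); first exact: (history_offer H).
    by move=> j _; rewrite index_le_old // r_old // al_old.
  rewrite (eq_bigr (fun j => city_offer c st t' j i)); last first.
    move=> j _; rewrite city_offerE /step_r /step_al ln; case: leqP => // jl.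
    by rewrite (index_new ln jl).
  (* An open facility gets no positive offer: connected cities are at a nearest open facility, and
     [t'] exceeds the distance of no waiting city. *)
  have [io|] := boolP (i \in st_open st); last exact: offer_le.
  rewrite big1 // => j _; rewrite city_offerE; apply/max_idPr; rewrite subr_le0.
  by case: ifP => [uj|/negbT uj]; [apply: wait|apply: (inv_best inv)].
- move=> i j l l'; rewrite mem_cat => /orP[lo'|ln'] /andP[jl ll'].
    rewrite (index_le_old _ lo') in ll'; have lo := index_le_mem lo' ll'.
    rewrite (index_le_old _ lo) in jl.
    by rewrite r_old // al_old // (history_triangle H) // jl.
  rewrite {1}/step_al ln'.
  have ge0 (x : R) : 0 <= Num.sqrt x by apply: sqrtr_ge0.
  (* The waiting city [l'] has not passed the facility [i0] of [j], so [t' <= c i0 l']; the squared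
     metric then goes through [j] and [i]. *)
  have conn_case (uj : ~~ unconnected st j) :
      Num.sqrt t' <= Num.sqrt (conn_dist st j) + Num.sqrt (c i j) + Num.sqrt (c i l').
    rewrite /conn_dist; move: uj; rewrite /unconnected; case E: st_conn => [i0|//] _.
    apply: le_trans (c_sqm i0 i l' j).
    by rewrite ler_wsqrtr // wait ?new_unconnected // (inv_open inv E).
  case: (boolP (l \in new)) => [ln|lnn].
    rewrite /step_r ln; case: ifP => [_|/negbT]; last exact: conn_case.
    by rewrite -addrA lerDl addr_ge0.
  have lo : l \in ord.
    have : l \in ord ++ new by rewrite -index_mem (leq_ltn_trans ll') // index_mem mem_cat ln' orbT.
    by rewrite mem_cat (negbTE lnn) orbF.
  rewrite r_old //; rewrite (index_le_old _ lo) in jl.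
  apply: le_trans (conn_case _) _; first by rewrite -(inv_ord inv) (index_le_mem lo jl).
  by rewrite -!addrA lerD2r ler_wsqrtr // (inv_r_ge inv).
Qed.

End Step.
End A2Invariant.

(** * Preservation of the history by each event, and existence of complete runs *)

Section A2Run.
Variables (R : realType) (C F : finType) (c : F -> C -> R) (f : F -> R).
Hypothesis c_ge0 : forall i j, 0 <= c i j.
Hypothesis f_ge0 : forall i, 0 <= f i.
Hypothesis c_sqm : squared_metric c.
Implicit Types (st : A2state R C F) (i : F) (j l : C) (ord : seq C).

Definition has_history st := exists ord al r, A2inv c f st ord al r.

(** The first exact payment is a trigger, hence not before [t'], and offers only grow with time. *)
Lemma no_trigger_offer_le st t' i : has_history st -> (exists j, unconnected st j) ->
  (forall s, st_time st <= s -> s < t' -> ~ trigger f c st s) ->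
  i \notin st_open st -> total_offer c st t' i <= f i.
Proof.
move=> [ord [al [r inv]]] ex notrig io.
have [s ss [sE _]] := first_payment ex (inv_offer_le inv io).
rewrite -sE; apply: total_offer_mono; rewrite leNgt; apply/negP => lt.
by apply: (notrig s ss lt); right; exists i.
Qed.

Lemma no_trigger_wait st t' i j : has_history st ->
  (forall s, st_time st <= s -> s < t' -> ~ trigger f c st s) ->
  unconnected st j -> i \in st_open st -> t' <= c i j.
Proof.
move=> [ord [al [r inv]]] notrig uj io; rewrite leNgt; apply/negP => lt.
by apply: (notrig (c i j) (inv_wait inv uj io) lt); left; exists j, i.
Qed.

Lemma connect_history st t' j0 i0 : has_history st -> st_time st <= t' ->
  (forall i, i \notin st_open st -> total_offer c st t' i <= f i) ->
  (forall j i, unconnected st j -> i \in st_open st -> t' <= c i j) ->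
  unconnected st j0 -> i0 \in st_open st -> t' = c i0 j0 ->
  has_history (mkA2state t' (st_open st) (fun k => if k == j0 then Some i0 else st_conn st k)).
Proof.
move=> [ord [al [r inv]]] time_le offer_le wait uj0 io0 t'E.
set st' := mkA2state _ _ _.
have unc' j : unconnected st' j = (j != j0) && unconnected st j.
  by rewrite /unconnected /=; case: (j == j0).
have new_unc j : j \in [:: j0] -> unconnected st j by rewrite inE => /eqP ->.
have cd' j : conn_dist c st' j = if j == j0 then t' else conn_dist c st j.
  by rewrite /conn_dist /=; case: eqP => // ->.
have cd_le j : ~~ unconnected st j -> conn_dist c st' j = conn_dist c st j.
  by rewrite cd'; case: eqP => // ->; rewrite uj0.
exists (ord ++ [:: j0]), (step_al al t' [:: j0]), (step_r c st r t' [:: j0]).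
split => /=.
- exact: (step_history c_ge0 f_ge0 c_sqm inv).
- exact: le_trans (inv_time inv) time_le.
- by move=> j; rewrite mem_cat mem_seq1 (inv_ord inv) unc' negb_and negbK orbC.
- by move=> j i; case: eqP => [_ [<-]//|_]; apply: (inv_open inv).
- move=> j i; rewrite unc' cd'; case: eqP => [-> _|_ /=]; first exact: wait.
  exact: (inv_best inv).
- by move=> j i; rewrite unc' => /andP[_]; apply: wait.
- move=> i io; apply: le_trans (offer_le i io); apply: ler_sum => j _.
  by rewrite !city_offerE unc' cd'; case: eqP => [->|//]; rewrite uj0.
- rewrite (inv_paid inv) [RHS](bigD1 j0) /=; last by rewrite unc' eqxx.
  rewrite {1}/step_al mem_seq1 eqxx cd' eqxx subrr add0r.
  apply: eq_big => j.
    by rewrite unc'; case: eqP => [->|]; rewrite ?uj0 ?andbF ?andbT.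
  move=> uj; rewrite cd_le // /step_al mem_seq1; case: eqP => // jE.
  by move: uj; rewrite jE uj0.
- move=> j; rewrite /step_al mem_cat => /orP[jo|->//]; case: ifP => // _.
  exact: le_trans (inv_al_le inv jo) time_le.
move=> j l; rewrite mem_cat => /orP[lo|ln] jl.
  have ln : (l \in [:: j0]) = false.
    by apply/negP => /new_unc; move: lo; rewrite (inv_ord inv) => /negbTE ->.
  have jo : j \in ord.
    have lt : (index l (ord ++ [:: j0]) < size ord)%N by rewrite index_cat lo index_mem.
    have := leq_ltn_trans jl lt; rewrite index_cat; case: ifP => // _.
    by rewrite ltnNge leq_addr.
  have uj : ~~ unconnected st j by rewrite -(inv_ord inv).
  rewrite /step_r ln cd_le // (inv_r_ge inv) //.
  by move: jl; rewrite !index_cat lo jo.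
rewrite /step_r ln cd'; case: eqP => [->|jn]; first by rewrite uj0.
by case: ifP => // uj; rewrite /conn_dist; move: uj; rewrite /unconnected => /eqP ->;
   apply: le_trans (inv_time inv) time_le.
Qed.

Lemma open_history st t' i0 : has_history st -> st_time st <= t' ->
  (forall i, i \notin st_open st -> total_offer c st t' i <= f i) ->
  (forall j i, unconnected st j -> i \in st_open st -> t' <= c i j) ->
  i0 \notin st_open st -> total_offer c st t' i0 = f i0 ->
  has_history (mkA2state t' (i0 |: st_open st)
    (fun k => if 0 < city_offer c st t' k i0 then Some i0 else st_conn st k)).
Proof.
move=> [ord [al [r inv]]] time_le offer_le wait io0 paid.
set st' := mkA2state _ _ _.
(* All these cities have budget [t'], so any enumeration order keeps the history sorted. *)
pose new := [seq j <- enum C | unconnected st j && (0 < city_offer c st t' j i0)].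
have newE j : (j \in new) = unconnected st j && (0 < city_offer c st t' j i0).
  by rewrite mem_filter mem_enum andbT.
have new_uniq : uniq new by rewrite filter_uniq // enum_uniq.
have new_unc j : j \in new -> unconnected st j by rewrite newE => /andP[].
have unc' j : unconnected st' j = unconnected st j && ~~ (0 < city_offer c st t' j i0).
  by rewrite /unconnected /=; case: ifP; rewrite ?andbF ?andbT.
have cd' j : conn_dist c st' j =
    if 0 < city_offer c st t' j i0 then c i0 j else conn_dist c st j.
  by rewrite /conn_dist /=; case: ifP.
have t'0 : 0 <= t' by apply: le_trans (inv_time inv) time_le.
have cd'_le j : conn_dist c st' j <= if unconnected st j then t' else conn_dist c st j.
  rewrite cd' city_offerE lt_max ltxx orbF subr_gt0; case: ifP => [/ltW //|_].
  by case: ifP => //; rewrite /conn_dist /unconnected => /eqP ->.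
(* The price drops by exactly the offer; cities that stay unconnected are excluded. *)
have cd'_pos j : ~~ unconnected st j \/ 0 < city_offer c st t' j i0 ->
    conn_dist c st' j = (if unconnected st j then t' else conn_dist c st j) -
      city_offer c st t' j i0.
  rewrite cd' city_offerE lt_max ltxx orbF subr_gt0 => H.
  case: ltP H => [lt _|le [nu|//]]; first by rewrite max_l ?subr_ge0 ?ltW //; set X := if _ then _ else _; rewrite opprB addrC subrK.
  by rewrite (negbTE nu) in le *; rewrite max_r ?subr0 // subr_le0.
exists (ord ++ new), (step_al al t' new), (step_r c st r t' new).
split => /=.
- exact: (step_history c_ge0 f_ge0 c_sqm inv).
- by [].
- by move=> j; rewrite mem_cat (inv_ord inv) newE unc'; case: unconnected; rewrite ?negbK.
- move=> j i; case: ifP => [_ [<-]|_ /(inv_open inv)]; rewrite in_setU1 ?eqxx // => ->.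
  by rewrite orbT.
- move=> j i; rewrite unc' in_setU1 => uj /orP[/eqP ->|io].
    rewrite cd'; case: ifP => // off; have nu : ~~ unconnected st j.
      by move: uj; rewrite negb_and off orbF.
    by move: off; rewrite city_offerE (negbTE nu) lt_max ltxx orbF subr_gt0 => /negbT; rewrite -leNgt.
  by apply: le_trans (cd'_le j) _; case: ifP => [u|/negbT u];
    [apply: wait|apply: (inv_best inv)].
- move=> j i; rewrite unc' in_setU1 => /andP[uj off] /orP[/eqP ->|]; last exact: wait.
  by move: off; rewrite city_offerE uj lt_max ltxx orbF subr_gt0 -leNgt.
- move=> i; rewrite in_setU1 negb_or => /andP[_ io].
  apply: le_trans (offer_le i io); apply: ler_sum => j _.
  rewrite !(city_offerE c _ _ j i) ge_max !le_max lexx !orbT andbT; apply/orP; left.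
  rewrite lerD2r unc'; case: ifP => [/andP[-> _]//|_]; exact: cd'_le.
- rewrite big_setU1 //= -paid (inv_paid inv) /total_offer.
  rewrite [X in _ + X = _]big_mkcond [RHS]big_mkcond -big_split /=; apply: eq_bigr => j _.
  rewrite unc' /step_al newE; case: (boolP (unconnected st j)) => uj /=.
    rewrite negbK addr0; case: ifP => off; last first.
      by apply/le_anti; rewrite city_offer_ge0 andbT leNgt off.
    by rewrite cd'_pos; [rewrite uj off /= opprB addrC subrK|right].
  by rewrite cd'_pos; [rewrite (negbTE uj) /=; ring|left].
- move=> j; rewrite /step_al mem_cat => /orP[jo|->//]; case: ifP => // _.
  exact: le_trans (inv_al_le inv jo) time_le.
move=> j l; rewrite mem_cat => /orP[lo|ln] jl.
  have ln : (l \in new) = false.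
    by apply/negP => /new_unc; move: lo; rewrite (inv_ord inv) => /negbTE ->.
  have jo : j \in ord.
    have lt : (index l (ord ++ new) < size ord)%N by rewrite index_cat lo index_mem.
    have := leq_ltn_trans jl lt; rewrite index_cat; case: ifP => // _.
    by rewrite ltnNge leq_addr.
  have uj : ~~ unconnected st j by rewrite -(inv_ord inv).
  rewrite /step_r ln; apply: le_trans (cd'_le j) _; rewrite (negbTE uj) (inv_r_ge inv) //.
  by move: jl; rewrite !index_cat lo jo.
by rewrite /step_r ln; apply: cd'_le.
Qed.

Lemma A2step_history st st' : has_history st -> A2step f c st st' -> has_history st'.
Proof.
move=> H [ex [t' [time_le [_ [notrig ev]]]]].
have offer_le i := @no_trigger_offer_le st t' i H ex notrig.
have wait j i := @no_trigger_wait st t' i j H notrig.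
case: ev => [[j [i [uj [io [t'E ->]]]]]|[i [io [paid ->]]]].
  exact: connect_history.
exact: open_history.
Qed.

Lemma A2reach_history st : A2reach f c st -> has_history st.
Proof.
elim=> [|st1 st2 _ IH step]; last exact: A2step_history step.
by exists [::], (fun=> 0), (fun _ _ => 0); apply: A2inv_init.
Qed.

(** Every facility has a first event of its own: reaching the nearest unconnected city if open,
    being paid if not. The earliest over the finitely many facilities is the next event. *)
Lemma A2step_exists st : [set: F] != set0 -> has_history st ->
  (exists j, unconnected st j) -> exists st', A2step f c st st'.
Proof.
move=> Fn0 H ex; have [ord [al [r inv]]] := H.
pose ev i s := if i \in st_open st then exists2 j, unconnected st j & s = c i j
               else total_offer c st s i = f i.
have first i : exists s, [/\ st_time st <= s, ev i s &
    forall s', st_time st <= s' -> ev i s' -> s <= s'].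
  rewrite /ev; case: (boolP (i \in st_open st)) => io.
    have [j0 uj0] := ex.
    case: (@arg_minP _ _ _ j0 (unconnected st) (c i) uj0) => j uj jmin.
    exists (c i j); split; [exact: (inv_wait inv)|by exists j|].
    by move=> s' _ [j' uj' ->]; apply: jmin.
  have [s ss [sE smin]] := first_payment ex (inv_offer_le inv io).
  by exists s.
have [T TP] := choice first.
have [i0 _] : exists i0 : F, i0 \in [set: F] by apply/set0Pn.
case: (@arg_minP _ _ _ i0 xpredT T isT) => i _ imin.
have [ss evi _] := TP i.
have notrig s : st_time st <= s -> s < T i -> ~ trigger f c st s.
  move=> st_s lts trig; move: lts; apply/negP; rewrite -leNgt.
  suff [i' evi'] : exists i', ev i' s.
    by apply: le_trans (imin i' isT) _; have [_ _] := TP i'; apply.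
  case: trig => [[j [i' [uj [io sE]]]]|[i' [io sE]]]; exists i'; rewrite /ev.
    by rewrite io; exists j.
  by rewrite (negbTE io).
move: evi; rewrite /ev; case: ifP => [io [j uj TE]|/negbT io paid].
- exists (mkA2state (T i) (st_open st) (fun k => if k == j then Some i else st_conn st k)).
  split=> //; exists (T i); split=> //; split; first by left; exists j, i.
  by split=> //; left; exists j, i.
- exists (mkA2state (T i) (i |: st_open st)
    (fun k => if 0 < city_offer c st (T i) k i then Some i else st_conn st k)).
  split=> //; exists (T i); split=> //; split; first by right; exists i.
  by split=> //; right; exists i.
Qed.

(** The second summand handles openings that connect no new city. *)
Definition A2measure st := (#|[pred j | unconnected st j]| + #|~: st_open st|)%N.

Lemma A2step_measure st st' : A2step f c st st' -> (A2measure st' < A2measure st)%N.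
Proof.
move=> [_ [t' [_ [_ [_ ev]]]]]; rewrite /A2measure.
case: ev => [[j [i [uj [io [t'E ->]]]]]|[i [io [paid ->]]]] /=.
  rewrite ltn_add2r; apply: proper_card; apply/properP; split.
    by apply/subsetP => k; rewrite !inE /unconnected /=; case: (k == j).
  by exists j; rewrite !inE // /unconnected /= eqxx.
rewrite -addnS; apply: leq_add.
  apply: subset_leq_card; apply/subsetP => k; rewrite !inE /unconnected /=.
  by case: ifP.
apply: proper_card; apply/properP; split.
  by rewrite setCS; apply: subsetUr.
by exists i; rewrite !inE ?eqxx.
Qed.

Lemma A2_exists : [set: F] != set0 -> exists S, A2 f c S.
Proof.
move=> Fn0.
suff [st [re conn]] : exists st, A2reach f c st /\ forall j, ~~ unconnected st j.
  by exists (st_open st), st.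
have [n] := ubnP (A2measure (A2init R C F)).
elim: n (A2init R C F) (A2reach_init f c) => // n IH st re; rewrite ltnS => le.
have [/forallP|] := boolP [forall j, ~~ unconnected st j]; first by exists st.
rewrite negb_forall => /existsP[j]; rewrite negbK => uj.
have [st' step] := A2step_exists Fn0 (A2reach_history re) (ex_intro _ j uj).
by apply: (IH st'); [exact: A2reach_step step|exact: leq_trans (A2step_measure step) le].
Qed.

End A2Run.

(** * The bifactor guarantee of the first phase *)

Section ConnCost.
Variables (R : realType) (C F : finType) (c : F -> C -> R).
Implicit Types (S : {set F}) (i : F) (j : C).

Lemma conn_cost_le S i j : i \in S -> conn_cost c S j <= c i j.
Proof.
rewrite /conn_cost => iS; case: pickP => [i0 _|/(_ i)]; last by rewrite iS.
exact: bigmin_le_cond.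
Qed.

Lemma conn_cost_attained S j : S != set0 -> exists2 i, i \in S & conn_cost c S j = c i j.
Proof.
move=> /set0Pn[i1 i1S]; rewrite /conn_cost; case: pickP => [i0 i0S|/(_ i1)]; last by rewrite i1S.
elim/big_ind: _ => [|x y [i iS ->] [i' i'S ->]|i iS]; [by exists i0| |by exists i].
by rewrite /Num.min; case: ifP => _; [exists i|exists i'].
Qed.

Lemma conn_cost_ge0 S j : (forall i j, 0 <= c i j) -> 0 <= conn_cost c S j.
Proof.
move=> c0; rewrite /conn_cost; case: pickP => // i0 _.
by elim/big_ind: _ => // x y x0 y0; rewrite le_min x0.
Qed.

End ConnCost.

Section Bifactor.
Variables (R : realType) (C F : finType) (c : F -> C -> R) (f : F -> R).
Hypothesis c_ge0 : forall i j, 0 <= c i j.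
Hypothesis f_ge0 : forall i, 0 <= f i.
Hypothesis c_sqm : squared_metric c.

(** Filtering preserves the order of connection, and cities outside the star only contribute
    nonnegative offers, so dropping them keeps the offer bound. *)
Lemma history_star ord al r (i : F) (D : pred C) x0 :
  star_history c f ord al r ->
  let s := filter D ord in
  star (size s) (fun m => al (nth x0 s m)) (fun m => c i (nth x0 s m))
    (fun m n => r (nth x0 s m) (nth x0 s n)) (f i).
Proof.
move=> H s.
have sord m : (m < size s)%N -> nth x0 s m \in ord.
  by move=> ms; have := mem_nth x0 ms; rewrite mem_filter => /andP[].
have lt_index m n : (m < n < size s)%N ->
    (index (nth x0 s m) ord < index (nth x0 s n) ord)%N.
  move=> /andP[mn ns].
  have srt : sorted (fun x y => index x ord < index y ord)%N s.
    apply: sorted_filter; first by move=> x y z; apply: ltn_trans.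
    rewrite -[X in sorted _ X](take_size ord) -(map_nth_iota0 x0 (leqnn _)) sorted_map.
    apply: (@sub_in_sorted _ (fun a => (a < size ord)%N) ltn _ _ _ _ (iota_ltn_sorted 0 (size ord))).
      by move=> a b al' bl ab /=; rewrite !index_uniq ?(history_uniq H).
    by apply/allP => k; rewrite mem_iota.
  apply: (sorted_ltn_nth _ _ srt) => //; first by move=> x y z; apply: ltn_trans.
  by rewrite inE (ltn_trans mn ns).
have le_index m n : (m <= n < size s)%N ->
    (index (nth x0 s m) ord <= index (nth x0 s n) ord)%N.
  case/andP; rewrite leq_eqVlt => /orP[/eqP -> //|mn] ns.
  by apply/ltnW/lt_index; rewrite mn.
have s_uniq : uniq s by rewrite filter_uniq // (history_uniq H).
split.
- by move=> m ms; apply: (history_ge0 H); apply: sord.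
- by move=> m _.
- by move=> m n /[dup]/andP[_ ns] mn; apply: (history_r_ge0 H); [apply: sord|apply: le_index].
- by move=> m ms; apply: (history_diag H); apply: sord.
- by move=> m n /[dup]/andP[_ ns] mn; apply: (history_sorted H); [apply: sord|apply: le_index].
- move=> n ns; apply: le_trans (history_offer H i (sord n ns)).
  set l := nth x0 s n.
  pose G j := Num.max ((if (index j ord <= index l ord)%N then r j l else al l) - c i j) 0.
  apply: (@le_trans _ _ (\sum_(j <- s) G j)).
    rewrite (big_nth x0) big_mkord le_eqVlt; apply/orP; left; apply/eqP; apply: eq_bigr => m _.
    rewrite /G; case: leqP => mn; first by rewrite le_index // mn.
    by rewrite leqNgt lt_index // mn ltn_ord.
  rewrite big_uniq //= [leRHS](bigID (mem s)) /= lerDl.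
  by apply: sumr_ge0 => j _; rewrite le_max lexx orbT.
- move=> m n n' mn /andP[nn' n's]; apply: (history_triangle H); first exact: sord.
  by rewrite !le_index ?mn ?nn' //= (leq_ltn_trans nn' n's).
Qed.

(** By [inv_paid] the budgets pay for the whole solution. Each city is assigned to a nearest
    facility of [F'], and [star_bound] is summed over these stars. The first conjunct serves the
    greedy phase, whose analysis starts from a nonempty set, as [conn_cost] is 0 by convention on
    the empty one. *)
Lemma A2_bifactor S : A2 f c S ->
  (#|C| = 0%N \/ S != set0) /\
  forall F' : {set F}, F' != set0 ->
    \sum_(i in S) f i + \sum_j conn_cost c S j <=
      29 / 20 * (\sum_(i in F') f i) + 6807 / 2000 * \sum_j conn_cost c F' j.
Proof.
move=> [st [re [conn <-]]].
have [ord [al [r inv]]] := A2reach_history c_ge0 f_ge0 c_sqm re.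
have connE j : exists2 i, st_conn st j = Some i & i \in st_open st.
  have := conn j; rewrite /unconnected; case E: st_conn => [i|//] _.
  by exists i => //; apply: (inv_open inv E).
split.
  have [C0|] := posnP #|C|; first by left.
  move/card_gt0P => [j _]; have [i _ io] := connE j.
  by right; apply/set0Pn; exists i.
move=> F' F'n0; have H := inv_history inv.
have ordT j : j \in ord by rewrite (inv_ord inv).
have paid : \sum_(i in st_open st) f i + \sum_j conn_dist c st j = \sum_j al j.
  rewrite (inv_paid inv) (eq_bigl xpredT) => [|j]; last by rewrite conn.
  by rewrite sumrB subrK.
apply: (@le_trans _ _ (\sum_j al j)).
  rewrite -paid lerD2l; apply: ler_sum => j _; rewrite /conn_dist.
  by have [i -> io] := connE j; apply: conn_cost_le.
have [phi phiP] := choice (fun j => ex2_ind (fun i a b => ex_intro _ i (conj a b)) (conn_cost_attained c j F'n0)).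
rewrite (partition_big phi (mem F')) /=; last by move=> j _; have [] := phiP j.
have -> : \sum_j conn_cost c F' j = \sum_(i in F') \sum_(j | phi j == i) c i j.
  rewrite (partition_big phi (mem F')) /=; last by move=> j _; have [] := phiP j.
  apply: eq_bigr => i iF; apply: eq_bigr => j /eqP <-.
  by have [] := phiP j.
rewrite !mulr_sumr -big_split /=; apply: ler_sum => i _.
case: (pickP (fun j : C => true)) => [x0 _|noC]; last first.
  have ratio_ge0 : 0 <= 29 / 20 :> R by lra.
  have no_city (P : pred C) (g : C -> R) : \sum_(j | P j) g j = 0.
    by rewrite big_pred0 // => j; have := noC j.
  by rewrite !no_city mulr0 addr0; apply: mulr_ge0.
have ord_perm : perm_eq ord (index_enum C).
  apply: uniq_perm; rewrite ?(history_uniq H) ?index_enum_uniq // => j.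
  by rewrite ordT mem_index_enum.
pose s := [seq j <- ord | phi j == i].
have sumE (g : C -> R) : \sum_(m < size s) g (nth x0 s m) = \sum_(j | phi j == i) g j.
  rewrite -(big_mkord xpredT (fun m => g (nth x0 s m))) -(big_nth x0 xpredT) big_filter.
  by rewrite (perm_big _ ord_perm).
have := star_bound (f_ge0 i) (history_star i (fun j => phi j == i) x0 H).
by rewrite -/s !sumE.
Qed.

End Bifactor.

(** * Greedy augmentation *)

Section Potential.
Variable R : realType.
Implicit Types x y : R.

Lemma ln_sub_ge x y : 0 < x -> 0 < y -> 1 - y / x <= ln x - ln y.
Proof.
move=> x0 y0.
have : ln (1 + (y / x - 1)) <= y / x - 1.
  by apply: le_ln1Dx; have : 0 < y / x := divr_gt0 y0 x0; lra.
rewrite addrC subrK ln_div ?posrE //; lra.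
Qed.

Lemma series_exp_coeff_le x n : 0 <= x -> series (exp_coeff x) n <= expR x.
Proof.
move=> x0; apply: nondecreasing_cvgn_le; last exact: is_cvg_series_exp_coeff.
apply/nondecreasing_seqP => m; rewrite /series /= big_nat_recr //= lerDl.
exact: exp_coeff_ge0.
Qed.

(** The bound 0.72 is what 2.17 leaves after 1.45; seven terms of the exponential series at 0.72
    already exceed 2.0543. *)
Lemma ln_scaling_le : ln (20543 / 10000 : R) <= 18 / 25.
Proof.
rewrite -ler_expR lnK ?posrE; last by rewrite divr_gt0 ?ltr0n.
have x0 : 0 <= 18 / 25 :> R by lra.
apply: le_trans (series_exp_coeff_le 7 x0).
rewrite /series /= !big_nat_recr //= big_geq // /exp_coeff /= !factS fact0.
lra.
Qed.

Variables Fs Cs : R.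
Hypothesis Fs_ge0 : 0 <= Fs.

(* [potential x] bounds the connection cost plus the opening costs that greedy
   augmentation still pays from connection cost [x], when compared with a
   solution of opening cost [Fs] and connection cost [Cs]. *)
Definition potential x : R :=
  if x - Cs <= Fs then x else Fs * (ln (x - Cs) - ln Fs) + Fs + Cs.

(** The slope of [potential] at [x] is 1 up to [Cs + Fs] and [Fs / (x - Cs)] beyond, so it is
    concave: its drop from [x] to [x'] is at least that slope times [x - x'], which the hypotheses
    compare with [g]. *)
Lemma potential_drop x x' g : x' <= x -> g <= x - x' -> g * (x - Cs) <= Fs * (x - x') ->
  g <= potential x - potential x'.
Proof.
move=> xx' gx gF; rewrite /potential.
case: (lerP (x - Cs) Fs) => hx; case: (lerP (x' - Cs) Fs) => hx'; [lra|lra| |].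
- have y0 := le_lt_trans Fs_ge0 hx; have y_neq0 : x - Cs != 0 by rewrite gt_eqF.
  have gy : g <= Fs * (x - x') / (x - Cs) by rewrite ler_pdivlMr.
  have [F0|F0] : 0 < Fs \/ Fs = 0 by move: Fs_ge0; rewrite le_eqVlt => /orP[/eqP|]; [right|left].
    have := ler_wpM2l Fs_ge0 (ln_sub_ge y0 F0).
    have : 0 <= (Fs - (x' - Cs)) * (1 - Fs / (x - Cs)).
      by rewrite mulr_ge0 ?subr_ge0 // ler_pdivrMr ?mul1r // ltW.
    have E : Fs * (x - x') / (x - Cs) = Fs - Fs * (x' - Cs) / (x - Cs) by field.
    rewrite E in gy; move: gy; set z := (x - Cs)^-1; lra.
  (* For [Fs = 0] the potential is the minimum of [x] and [Cs], and the logarithm disappears. *)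
  rewrite F0 !mul0r in gy *; lra.
- have y0 := le_lt_trans Fs_ge0 hx; have y'0 := le_lt_trans Fs_ge0 hx'.
  have y_neq0 : x - Cs != 0 by rewrite gt_eqF.
  have gy : g <= Fs * (x - x') / (x - Cs) by rewrite ler_pdivlMr.
  have := ler_wpM2l Fs_ge0 (ln_sub_ge y0 y'0).
  have E : Fs * (x - x') / (x - Cs) = Fs * (1 - (x' - Cs) / (x - Cs)) by field.
  rewrite E in gy; lra.
Qed.

(** By concavity: the line has slope [1 / t] and touches the potential at [x - Cs = t * Fs]. *)
Lemma potential_le_tangent x t : 1 <= t -> potential x <= Fs * ln t + Cs + (x - Cs) / t.
Proof.
move=> t1; have t0 : 0 < t by lra.
rewrite /potential; case: (lerP (x - Cs) Fs) => hx; set y := x - Cs in hx *.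
  have := ln_sub_ge t0 (@ltr01 R); rewrite ln1 subr0 div1r => /(ler_wpM2l Fs_ge0) L.
  have : y * (1 - t^-1) <= Fs * (1 - t^-1).
    by rewrite ler_wpM2r ?subr_ge0 ?invf_le1.
  have -> : x = Cs + y by rewrite /y; ring.
  rewrite mulrBr mulr1; lra.
have [F0|F0] : 0 < Fs \/ Fs = 0 by move: Fs_ge0; rewrite le_eqVlt => /orP[/eqP|]; [right|left].
  have y0 : 0 < y by lra.
  have /(ler_wpM2l Fs_ge0) := ln_sub_ge (mulr_gt0 t0 F0) y0.
  rewrite lnM ?posrE // mulrBr mulr1.
  have -> : Fs * (y / (t * Fs)) = y / t by field; rewrite !gt_eqF.
  lra.
rewrite F0 !mul0r add0r; have : 0 <= y / t by rewrite divr_ge0 ?ltW // -F0.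
lra.
Qed.

End Potential.

Section Greedy.
Variables (R : realType) (C F : finType) (c : F -> C -> R) (f : F -> R).
Hypothesis c_ge0 : forall i j, 0 <= c i j.
Hypothesis f_ge0 : forall i, 0 <= f i.
Implicit Types (S : {set F}) (i : F).

Let Fc S : R := \sum_(i in S) f i.
Let Cc S : R := \sum_j conn_cost c S j.

Lemma conn_cost_setU1_le S i j : S != set0 ->
  conn_cost c (i |: S) j <= conn_cost c S j.
Proof.
move=> S0; have [i' i'S ->] := conn_cost_attained c j S0.
by apply: conn_cost_le; rewrite in_setU1 i'S orbT.
Qed.

Lemma gainE S i : i \notin S -> gain f c S i = Cc S - Cc (i |: S) - f i.
Proof. by move=> iS; rewrite /gain /cost big_setU1 //= -/(Cc _) -/(Cc _); ring. Qed.

(** City by city: the facility serving [j] in [F'] alone yields the saving of [j] when added to [S];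
    if it is already in [S], there is nothing to save. *)
Lemma sum_conn_gain_ge S (F' : {set F}) : S != set0 -> F' != set0 ->
  Cc S - Cc F' <= \sum_(k in F' | k \notin S) (Cc S - Cc (k |: S)).
Proof.
move=> S0 F'0; rewrite /Cc -sumrB.
under [leRHS]eq_bigr do rewrite -sumrB.
rewrite exchange_big /=; apply: ler_sum => j _.
have [k kF' ->] := conn_cost_attained c j F'0.
have ge0 k' : 0 <= conn_cost c S j - conn_cost c (k' |: S) j.
  by rewrite subr_ge0 conn_cost_setU1_le.
have [kS|kS] := boolP (k \in S).
  by apply: (@le_trans _ _ 0); [rewrite subr_le0 conn_cost_le|apply: sumr_ge0].
rewrite (bigD1 k) /= ?kF' //; apply: (@le_trans _ _ (conn_cost c S j - conn_cost c (k |: S) j)).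
  by rewrite lerD2l lerN2 conn_cost_le // in_setU1 eqxx.
by rewrite lerDl; apply: sumr_ge0.
Qed.

Variable F' : {set F}.
Hypothesis F'_neq0 : F' != set0.

Let missing_le S : \sum_(k in F' | k \notin S) f k <= Fc F'.
Proof. by rewrite /Fc [leRHS](bigID (fun k => k \notin S)) /= lerDl sumr_ge0. Qed.

Let sum_gain_ge S : S != set0 ->
  Cc S - Cc F' - Fc F' <= \sum_(k in F' | k \notin S) gain f c S k.
Proof.
move=> S0; rewrite (eq_bigr (fun k => (Cc S - Cc (k |: S)) - f k)); last first.
  by move=> k /andP[_ kS]; rewrite gainE.
rewrite sumrB lerB ?missing_le //; exact: sum_conn_gain_ge.
Qed.

Lemma greedy_step_potential S S' : S != set0 -> greedy_step f c S S' ->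
  S' != set0 /\
  Fc S' + potential (Fc F') (Cc F') (Cc S') <= Fc S + potential (Fc F') (Cc F') (Cc S).
Proof.
move=> S0 [_ [i [iS [gi [imax ->]]]]]; split.
  by apply/set0Pn; exists i; rewrite in_setU1 eqxx.
have Fc0 : 0 <= Fc F' by apply: sumr_ge0.
have FcE : Fc (i |: S) = f i + Fc S by rewrite /Fc big_setU1.
have gE := gainE iS.
have Ci : Cc (i |: S) <= Cc S by apply: ler_sum => j _; apply: conn_cost_setU1_le.
suff : f i <= potential (Fc F') (Cc F') (Cc S) - potential (Fc F') (Cc F') (Cc (i |: S)) by lra.
apply: potential_drop => //; first by lra.
(* The greedy choice has at least the average ratio of gain to cost over the facilities of [F']
   missing from [S]. *)
have le_gain : (Cc S - Cc F' - Fc F') * f i <= gain f c S i * Fc F'.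
  apply: (le_trans (ler_wpM2r (f_ge0 i) (sum_gain_ge S0))).
  apply: (@le_trans _ _ (gain f c S i * \sum_(k in F' | k \notin S) f k)).
    by rewrite mulr_suml mulr_sumr; apply: ler_sum => k /andP[_]; apply: imax.
  by apply: ler_wpM2l; [apply: ltW|apply: missing_le].
move: le_gain; rewrite gE; lra.
Qed.

Lemma greedy_reach_potential S0 S : S0 != set0 -> greedy_reach f c S0 S ->
  S != set0 /\
  Fc S + potential (Fc F') (Cc F') (Cc S) <= Fc S0 + potential (Fc F') (Cc F') (Cc S0).
Proof.
move=> S00; elim=> [|S1 S2 _ [S1n0 le1] step]; first by [].
by have [S2n0 le2] := greedy_step_potential S1n0 step; split=> //; apply: le_trans le1.
Qed.

(** When no gain is left, the final connection cost lies in the linear range of the potential, which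
    is then the connection cost itself. *)
Lemma greedy_final_cost S0 S : S0 != set0 -> greedy_reach f c S0 S ->
  ~ (exists k, k \notin S /\ 0 < gain f c S k) ->
  cost f c S <= Fc S0 + potential (Fc F') (Cc F') (Cc S0).
Proof.
move=> S00 re stuck; have [Sn0] := greedy_reach_potential S00 re.
apply: le_trans; rewrite /cost lerD2l /potential.
have : Cc S - Cc F' - Fc F' <= 0.
  apply: le_trans (sum_gain_ge Sn0) _; apply: sumr_le0 => k /andP[_ kS].
  by rewrite leNgt; apply/negP => g0; apply: stuck; exists k.
by rewrite subr_le0 => ->.
Qed.

End Greedy.

Section GreedyExists.
Variables (R : realType) (C F : finType) (c : F -> C -> R) (f : F -> R).
Hypothesis f_ge0 : forall i, 0 <= f i.
Implicit Types (S : {set F}) (i : F).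

Lemma greedy_step_exists S : (exists k, k \notin S /\ 0 < gain f c S k) ->
  exists S', greedy_step f c S S'.
Proof.
move=> ex; have [k [kS gk]] := ex.
suff [i [iS gi imax]] : exists i, [/\ i \notin S, 0 < gain f c S i &
    forall k, k \notin S -> gain f c S k * f i <= gain f c S i * f k].
  by exists (i |: S); split=> //; exists i.
(* A free facility with positive gain has infinite ratio; only without one is the quotient
   maximized. *)
have [/existsP[i /and3P[iS gi /eqP fi]]|free] :=
    boolP [exists i, [&& i \notin S, 0 < gain f c S i & f i == 0]].
  exists i; split=> // k' _; rewrite fi mulr0 mulr_ge0 // ltW //.
have f_gt0 i : (i \notin S) && (0 < gain f c S i) -> 0 < f i.
  move=> /andP[iS gi]; rewrite lt_neqAle f_ge0 andbT eq_sym; apply/negP => fi.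
  by case/negP: free; apply/existsP; exists i; rewrite iS gi.
have kP : (k \notin S) && (0 < gain f c S k) by rewrite kS.
case: (@arg_maxP _ _ _ k [pred i | (i \notin S) && (0 < gain f c S i)]
  (fun i => gain f c S i / f i) kP) => i /= iP imax.
have /andP[iS gi] := iP; exists i; split=> // k' k'S.
have [g0|g0] := ltP 0 (gain f c S k'); last first.
  by apply: (@le_trans _ _ 0); [rewrite mulr_le0_ge0|rewrite mulr_ge0 // ltW].
have k'P : (k' \notin S) && (0 < gain f c S k') by rewrite k'S.
have := imax k' k'P.
by rewrite ler_pdivrMr ?f_gt0 // mulrAC ler_pdivlMr ?f_gt0.
Qed.

Lemma greedy_exists S0 : exists S, greedy_reach f c S0 S /\
  ~ (exists k, k \notin S /\ 0 < gain f c S k).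
Proof.
suff H n S : greedy_reach f c S0 S -> (#|~: S| < n)%N -> exists S', greedy_reach f c S0 S' /\
    ~ (exists k, k \notin S' /\ 0 < gain f c S' k).
  exact: (H _ S0 (greedy_refl f c S0) (leqnn _)).
elim: n S => // n IH S re; rewrite ltnS => leS.
have [ex|] := pselect (exists k, k \notin S /\ 0 < gain f c S k); last by exists S.
have [S' step] := greedy_step_exists ex.
apply: (IH S'); first exact: greedy_next step.
apply: leq_trans leS; have [_ [i [iS [_ [_ ->]]]]] := step.
apply: proper_card; apply/properP; split; first by rewrite setCS subsetUr.
by exists i; rewrite !inE ?eqxx.
Qed.

End GreedyExists.

(** * Combination of the two phases *)

(** Dividing the first-phase bound by [t] gives coefficient [29 / 20 + L] for [Fs] and
    [1 + (6807 / 2000 - 1) / t] for [Cs]; both are at most 2.17, the second because [4807 / 2000] is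
    2.4035. *)
Lemma combine_bounds (R : realFieldType) (t F1 C1 Fs Cs L p K : R) :
  0 < t -> 4807 / 2000 <= 117 / 100 * t -> 0 <= Fs -> 0 <= Cs -> L <= 18 / 25 ->
  t * F1 + C1 <= 29 / 20 * (t * Fs) + 6807 / 2000 * Cs ->
  p <= Fs * L + Cs + (C1 - Cs) / t -> K <= F1 + p -> K <= 217 / 100 * (Fs + Cs).
Proof.
move=> t0 tge Fs0 Cs0 L_le paid p_le K_le.
rewrite -(ler_pM2l t0).
have H1 := ler_wpM2l (ltW t0) (ler_wpM2l Fs0 L_le).
have H2 : t * p <= t * (Fs * L) + t * Cs + (C1 - Cs).
  apply: le_trans (ler_wpM2l (ltW t0) p_le) _.
  by rewrite !mulrDr [t * ((C1 - Cs) / t)]mulrC divfK ?gt_eqF.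
have H3 := ler_wpM2l (ltW t0) K_le.
have H4 := ler_wpM2r Cs0 tge.
lra.
Qed.

Lemma A3_approximation (R : realType) (C F : finType) (c : F -> C -> R) (f : F -> R) (t : R) :
  1 <= t -> 4807 / 2000 <= 117 / 100 * t -> ln t <= 18 / 25 ->
  [set: F] != set0 ->
  (forall i j, 0 <= c i j) -> (forall i, 0 <= f i) -> squared_metric c ->
  (exists S, A3 t f c S) /\
  (forall S, A3 t f c S ->
     forall F' : {set F}, F' != set0 -> cost f c S <= 217 / 100 * cost f c F').
Proof.
move=> t1 t_ge ln_t F0 c0 f0 sqm.
have t0 : 0 < t := lt_le_trans ltr01 t1.
have tf0 i : 0 <= t * f i by rewrite mulr_ge0 // ltW.
split.
  have [S0 A2S0] := A2_exists c0 tf0 sqm F0.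
  have [S [re stuck]] := greedy_exists c f0 S0.
  by exists S, S0.
move=> S [S0 [A2S0 [re stuck]]] F' F'0.
have [S0n /(_ _ F'0)] := A2_bifactor c0 tf0 sqm A2S0; rewrite -!mulr_sumr => bif.
have Fs0 : 0 <= \sum_(i in F') f i by apply: sumr_ge0.
have Cs0 : 0 <= \sum_j conn_cost c F' j by apply: sumr_ge0 => j _; apply: conn_cost_ge0.
(* Without cities no opening has positive gain, so the augmentation does nothing and the ratio 1.45
   of the first phase suffices. *)
case: S0n => [C0|S0n].
  have no_city (g : C -> R) : \sum_j g j = 0.
    by apply: big_pred0 => j; have := card0_eq C0 j.
  have costE (S1 : {set F}) : cost f c S1 = \sum_(i in S1) f i by rewrite /cost no_city addr0.
  have -> : S = S0.
    case: re => // S1 S2 _ [_ [i [iS1 [gi _]]]]; exfalso; move: gi.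
    by rewrite /gain !costE big_setU1 //= opprD addrCA subrr addr0 oppr_gt0 ltNge f0.
  move: bif; rewrite !costE !no_city !mulr0 !addr0 => bif.
  have : \sum_(i in S0) f i <= 29 / 20 * \sum_(i in F') f i.
    by rewrite -(ler_pM2l t0) mulrCA.
  lra.
have final := greedy_final_cost f0 F'0 S0n re stuck.
have := combine_bounds t0 t_ge Fs0 Cs0 ln_t bif (potential_le_tangent _ Fs0 _ t1) final.
exact.
Qed.

Theorem theorem3 (R : realType) (C F : finType) (c : F -> C -> R) (f : F -> R) :
  [set: F] != set0 ->
  (forall i j, 0 <= c i j) -> (forall i, 0 <= f i) -> squared_metric c ->
  (1 <= 20543 / 10000 :> R) /\
  (exists S, A3 (20543 / 10000) f c S) /\
  (forall S, A3 (20543 / 10000) f c S ->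
     forall F' : {set F}, F' != set0 -> cost f c S <= 217 / 100 * cost f c F').
Proof.
move=> F0 c0 f0 sqm.
have t1 : 1 <= 20543 / 10000 :> R by rewrite ler_pdivlMr ?ltr0n // mul1r ler_nat.
split; first exact: t1.
by apply: A3_approximation => //; [lra|exact: ln_scaling_le].
Qed.
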